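(* Suppose that $X_1,\dots,X_n$ are independent zero-mean real-valued random variables and $U_1,\dots,U_n$ are independent random variables uniformly distributed on $[0,1]$, which are also independent of $X_1,\dots,X_n$. For each $i=1,\dots,n$ let $$W_i:=|X_i-\mathsf{r}_i(X_i,(U_i)_{X_i})|,$$ where $\mathsf{r}_i$ is the reciprocating function of $X_i$ and $(U_i)_{X_i}$ is the randomization variable built from $X_i$ and $U_i$ (see context). Let $$S_W:=\frac{X_1+\dots+X_n}{\frac12\sqrt{W_1^2+\dots+W_n^2}},$$ where the rule $\frac00:=0$ is used if the denominator is zero. Then for every nonnegative Borel function $f$ on $\mathbb{R}$ $$\mathsf{E}f(S_W)\le\max\bigl(f(0),\,\sup\mathsf{E}f(Z_1+\dots+Z_n)\bigr),$$ where the supremum is taken over all $n$-tuples of independent zero-mean random variables $Z_1,\dots,Z_n$ with the property that each $Z_i$ takes on only two values, say $c_i$ and $d_i$ (each attained with positive probability; the degenerate case $c_i=d_i=0$ is allowed), such that $$\frac12\sqrt{(d_1-c_1)^2+\dots+(d_n-c_n)^2}=1.$$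
   Context: For a zero-mean real-valued random variable $X$ define $$G(x):=\begin{cases}\mathsf{E}X\,\mathbf{I}\{X\in(0,x]\} & \text{if } x\in[0,\infty],\\ \mathsf{E}(-X)\,\mathbf{I}\{X\in[x,0)\} & \text{if } x\in[-\infty,0],\end{cases}$$ ($\mathbf{I}\{\cdot\}$ is the indicator) and $m:=G(\infty)=G(-\infty)=\frac12\mathsf{E}|X|<\infty$. For $h\in[0,m]$ let $$x_+(h):=\inf\{x\in[0,\infty]\colon G(x)\ge h\},\qquad x_-(h):=\sup\{x\in[-\infty,0]\colon G(x)\ge h\}.$$ For $x\in\mathbb{R}$ and $u\in[0,1]$ let $$H(x,u):=\begin{cases}G(x-)+u\,(G(x)-G(x-)) & \text{if } x\in[0,\infty),\\ G(x+)+u\,(G(x)-G(x+)) & \text{if } x\in(-\infty,0],\end{cases}$$ where $G(x\mp)$ are one-sided limits ($G$ is continuous at $0$ with $G(0)=0$, so the two lines agree at $x=0$). The reciprocating function of (the distribution of) $X$ is $$\mathsf{r}(x,u):=\begin{cases}x_-(H(x,u)) & \text{if } x\in[0,\infty),\\ x_+(H(x,u)) & \text{if } x\in(-\infty,0].\end{cases}$$ If $U$ is uniformly distributed on $[0,1]$ and independent of $X$, then for real $x$ put $U_x:=U$ if $\mathsf{P}(X=x)\neq0$ and $U_x:=1$ if $\mathsf{P}(X=x)=0$, and $U_X(\omega):=U_{X(\omega)}(\omega)$. The objects $\mathsf{r}_i$ and $(U_i)_{X_i}$ are $\mathsf{r}$ and $U_X$ constructed from $X_i$ and $U_i$ in place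 of $X$ and $U$. *)

(* Defs.v *)
From HB Require Import structures.
From mathcomp Require Import all_boot all_order all_algebra.
From mathcomp Require Import all_classical all_reals all_analysis.

Set Implicit Arguments.
Unset Strict Implicit.
Unset Printing Implicit Defensive.

Import Order.TTheory GRing.Theory Num.Theory.
Import numFieldNormedType.Exports.

Local Open Scope classical_set_scope.
Local Open Scope ring_scope.

Section random_variables.
Context d (T : measurableType d) (R : realType) (P : probability T R).

Definition zero_mean (X : {RV P >-> R}) : Prop :=
  P.-integrable setT (EFin \o X) /\ ('E_P[X] = 0)%E.

Definition mutually_independent (I : finType) (X : I -> {RV P >-> R}) : Prop :=
  forall (J : {set I}) (A : I -> set R), (forall i, measurable (A i)) ->
    P (\bigcap_(i in [set` J]) X i @^-1` A i) =
    (\prod_(i in J) P (X i @^-1` A i))%E.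

Definition uniform01 (U : {RV P >-> R}) : Prop :=
  forall A : set R, measurable A ->
    distribution P U A = uniform_prob (@ltr01 R) A.

(* The case a = b is allowed; for a zero-mean X it forces a = b = 0. *)
Definition two_valued (X : {RV P >-> R}) (a b : R) : Prop :=
  [/\ P (X @^-1` [set a; b]) = 1%E,
      (0 < P (X @^-1` [set a]))%E & (0 < P (X @^-1` [set b]))%E].

End random_variables.

Section reciprocating_function.
Context d (T : measurableType d) (R : realType) (P : probability T R).
Variable X : {RV P >-> R}.

(* [fine] loses nothing here: the expectations are finite when X is
   integrable. *)
Definition recipG (x : \bar R) : R :=
  fine (if (0 <= x)%E
    then 'E_P[fun w => (X w * \1_[set t : R | 0 < t /\ (t%:E <= x)%E] (X w))%R]%E
    else 'E_P[fun w => (- X w * \1_[set t : R | (x <= t%:E)%E /\ t < 0] (X w))%R]%E).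

(* Extended values are genuine: x_plus (resp. x_minus) is infinite at
   h = E|X|/2 when X is unbounded above (resp. below). *)
Definition x_plus (h : R) : \bar R :=
  ereal_inf [set x : \bar R | (0 <= x)%E /\ h <= recipG x].

Definition x_minus (h : R) : \bar R :=
  ereal_sup [set x : \bar R | (x <= 0)%E /\ h <= recipG x].

Definition recipG_left (x : R) : R := lim (recipG y%:E @[y --> x^'-]).

Definition recipG_right (x : R) : R := lim (recipG y%:E @[y --> x^'+]).

Definition recipH (x u : R) : R :=
  if 0 <= x then recipG_left x + u * (recipG x%:E - recipG_left x)
  else recipG_right x + u * (recipG x%:E - recipG_right x).

Definition recip (x u : R) : \bar R :=
  if 0 <= x then x_minus (recipH x u) else x_plus (recipH x u).

Definition randomizer (U : {RV P >-> R}) (w : T) : R :=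
  if P (X @^-1` [set X w]) != 0%E then U w else 1.

End reciprocating_function.

Section self_normalized_sum.
Context d (T : measurableType d) (R : realType) (P : probability T R).
Variables (n : nat) (X U : 'I_n -> {RV P >-> R}).

Definition width (i : 'I_n) (w : T) : \bar R :=
  `|(X i w)%:E - recip (X i) (X i w) (randomizer (X i) (U i) w)|%E.

Definition half_root_width (w : T) : \bar R :=
  ((2^-1)%:E * sqrte (\sum_(i < n) (width i w ^+ 2)))%E.

(* A width may be infinite on a null event; there the denominator is +oo and
   the quotient is 0.  The denominator vanishes only if all the X i w do. *)
Definition self_normalized_sum (w : T) : R :=
  if half_root_width w == 0%E then 0
  else fine ((\sum_(i < n) X i w)%:E / half_root_width w)%E.

End self_normalized_sum.

(* Main.v *)
Require Import Defs.
From HB Require Import structures.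
From mathcomp Require Import all_boot all_order all_algebra.
From mathcomp Require Import all_classical all_reals all_analysis.
From mathcomp Require Import measurable_realfun ring.

Set Implicit Arguments.
Unset Strict Implicit.
Unset Printing Implicit Defensive.

Import Order.TTheory GRing.Theory Num.Theory.
Import numFieldNormedType.Exports.

Local Open Scope classical_set_scope.
Local Open Scope ring_scope.

(** The pair formed by a zero-mean variable X and its reciprocal value is a
mixture of two-point zero-mean pairs, and the bound follows by averaging.

One variable. Weight the event X > 0 by X and the event X < 0 by - X. As
E X = 0, both weighted laws have the same mass m = E|X| / 2. The randomized
transform V = H(X, U) carries each of them to Lebesgue measure on [0, m]
(mass_transform_pushforward), and X can be read off from V: it is x_plus V or
x_minus V almost everywhere. Put b(h) = x_plus h and a(h) = - x_minus h. Then
the width W is a(V) + b(V) almost surely, and undoing the weights gives, for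
every nonnegative Psi (reciprocal_disintegration),

  E Psi(X, W) = int_0^m (Psi(b, a + b) / b + Psi(- a, a + b) / a) dh
                + Psi(0, 0) P(X = 0).

The integrand is 1/a + 1/b times E Psi(Z, a + b), where Z takes the values b
and - a with probabilities a / (a + b) and b / (a + b), hence has mean zero.
Taking Psi = 1 shows that the weights 1/a + 1/b and P(X = 0) have total mass
one. So E Psi(X, W) cannot exceed all the two-point values E Psi(Z, a + b) and
Psi(0, 0) (two_point_bound).

Several variables. Almost surely f(S_W) is a function of the sum of the pairs
(X_i, W_i^2). The pair with index k is independent of the sum of the others,
so the expectation is that of some Psi(X_k, W_k), with Psi obtained by
integrating the others out (integral_partial_sum). If it is greater than c, the
one-variable result gives a and b such that it is still greater than c after
(X_k, W_k) has been replaced by (Z_k, a + b) (replace_one). The variable Z_k is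
taken to be a function of U_k, so all the pairs stay independent and no new
probability space is needed. After n replacements the denominator is a
constant D. If D = 0, all the Z_k vanish and the expectation is f(0); otherwise
the variables Z_k / D satisfy the constraint in the supremum. *)

(** * Measures with a density *)

Section density_measure.
Local Open Scope ereal_scope.
Context d (T : measurableType d) (R : realType) (mu : {measure set T -> \bar R}).
Variable Y : T -> R.

(** The proofs of measurability and nonnegativity are arguments so that the
measure structure can be attached to the constant. *)
Definition density_measure (mY : measurable_fun setT Y) (Y0 : forall x, (0 <= Y x)%R)
  (A : set T) : \bar R := \int[mu]_(x in A) (Y x)%:E.

Hypotheses (mY : measurable_fun setT Y) (Y0 : forall x, (0 <= Y x)%R).

Let mEY : measurable_fun setT (EFin \o Y).
Proof. exact/measurable_EFinP. Qed.

Let density0 : density_measure mY Y0 set0 = 0.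
Proof. by rewrite /density_measure integral_set0. Qed.

Let density_ge0 A : 0 <= density_measure mY Y0 A.
Proof. by apply: integral_ge0 => x _; rewrite lee_fin. Qed.

Let density_sigma_additive : semi_sigma_additive (density_measure mY Y0).
Proof.
move=> F mF tF mUF; rewrite /density_measure; apply: cvg_toP.
  apply: ereal_nondecreasing_is_cvgn => m n mn.
  by apply: lee_sum_nneg_natr => // k _ _; exact: density_ge0.
rewrite ge0_integral_bigcup//=; first exact: measurable_funTS.
by move=> x _; rewrite lee_fin.
Qed.

HB.instance Definition _ := isMeasure.Build _ _ _ (density_measure mY Y0)
  density0 density_ge0 density_sigma_additive.

Import HBNNSimple.

Let integral_density_nnsfun (f : {nnsfun T >-> R}) :
  \int[density_measure mY Y0]_x (f x)%:E = \int[mu]_x ((f x)%:E * (Y x)%:E).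
Proof.
under [LHS]eq_integral do rewrite fimfunE -fsumEFin//.
rewrite [LHS]ge0_integral_fsum//; last 2 first.
  - by move=> r; exact/measurable_EFinP/measurableT_comp.
  - by move=> n x _; rewrite EFinM nnfun_muleindic_ge0.
under [RHS]eq_integral.
  move=> x xD; rewrite fimfunE -fsumEFin// ge0_mule_fsuml; last first.
    by move=> r; rewrite EFinM nnfun_muleindic_ge0.
  over.
rewrite [RHS]ge0_integral_fsum//; last 2 first.
  - move=> r; apply: emeasurable_funM => //.
    by apply/measurable_EFinP; exact/measurableT_comp.
  - move=> n x _; apply: mule_ge0; rewrite ?lee_fin//.
    by rewrite -lee_fin EFinM nnfun_muleindic_ge0.
apply: eq_fsbigr => r _; rewrite integralZl_indic_nnsfun//= integral_indic// setIT.
under eq_integral do rewrite EFinM -muleA.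
have [r0|r0] := leP 0%R r; last first.
  rewrite preimage_nnfun0// measure0 mule0 integral0_eq// => x _.
  by rewrite indic0 mul0e mule0.
rewrite ge0_integralZl//; last 2 first.
  - by apply: emeasurable_funM => //; exact/measurable_EFinP.
  - by move=> x _; rewrite mule_ge0// lee_fin.
congr (_ * _); rewrite /density_measure [LHS]integral_mkcond.
by apply: eq_integral => x _; rewrite epatch_indic muleC.
Qed.

(** Both sides are limits along the same increasing sequence of simple
functions, for which the identity reduces to the definition of the measure. *)
Lemma ge0_integral_density (f : T -> \bar R) :
  measurable_fun setT f -> (forall x, 0 <= f x) ->
  \int[density_measure mY Y0]_x f x = \int[mu]_x (f x * (Y x)%:E).
Proof.
move=> mf f0; pose f_ := nnsfun_approx measurableT mf.
have f_cvg x : (f_ n x)%:E @[n --> \oo] --> f x by exact: cvg_nnsfun_approx.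
have f_nd x : {homo (fun n => (f_ n x)%:E) : m n / (m <= n)%N >-> m <= n}.
  by move=> m n mn; rewrite lee_fin; exact/lefP/nd_nnsfun_approx.
transitivity (lim (\int[density_measure mY Y0]_x (f_ n x)%:E @[n --> \oo])).
  rewrite -monotone_convergence//=.
  - by apply: eq_integral => x _; apply/esym/cvg_lim.
  - by move=> n; exact/measurable_EFinP/measurable_funTS.
  - by move=> n x _; rewrite lee_fin.
under eq_fun do rewrite integral_density_nnsfun.
rewrite -monotone_convergence//=.
- apply: eq_integral => x _; apply/cvg_lim => //.
  exact: cvgeZr.
- move=> n; apply: emeasurable_funM => //.
  exact/measurable_EFinP/measurable_funTS.
- by move=> n x _; rewrite mule_ge0// lee_fin.
- by move=> x _ m n mn; rewrite lee_wpmul2r// ?lee_fin//; exact: f_nd.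
Qed.

End density_measure.

(** * Independence of generated sigma-algebras *)

Section independence.
Local Open Scope ereal_scope.
Context d (T : measurableType d) (R : realType) (P : probability T R).

(** For fixed B, the two sides are finite measures in A, so agreement on a
pi-system extends to the sigma-algebra it generates. *)
Lemma independent_generated (G : set (set T)) (B : set T) :
  G `<=` measurable -> setI_closed G -> G setT -> measurable B ->
  (forall A, G A -> P (A `&` B) = P A * P B) ->
  forall A, <<s G >> A -> P (A `&` B) = P A * P B.
Proof.
move=> Gm GI GT mB GB A sA.
have PB0 : (0 <= fine (P B))%R by rewrite fine_ge0.
pose m1 := mrestr P mB; pose m2 := mscale (NngNum PB0) P.
have m2E C : m2 C = P C * P B.
  by rewrite /m2 /mscale/= fineK ?fin_num_measure// muleC.
rewrite -m2E -[LHS]/(m1 A).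
apply: (@g_sigma_algebra_measure_unique _ R T G Gm (fun=> setT)) => //.
- by rewrite bigcup_const.
- by move=> C GC; rewrite -[LHS]/(P (C `&` B)) GB// -m2E.
- by move=> _; rewrite /= /mrestr setTI -ge0_fin_numE// fin_num_measure.
Qed.

Lemma independent_generated2 (G H : set (set T)) :
  G `<=` measurable -> setI_closed G -> G setT ->
  H `<=` measurable -> setI_closed H -> H setT ->
  (forall A B, G A -> H B -> P (A `&` B) = P A * P B) ->
  forall A B, <<s G >> A -> <<s H >> B -> P (A `&` B) = P A * P B.
Proof.
move=> Gm GI GT Hm HI HT GH A B sA sB.
have sHm : <<s H >> `<=` measurable.
  by apply: smallest_sub => //; exact: sigma_algebra_measurable.
apply: (@independent_generated G) => //; first exact: sHm.
move=> C GC; rewrite setIC muleC.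
apply: (@independent_generated H) => //; first exact: Gm.
by move=> D HD; rewrite setIC muleC GH.
Qed.

Section cylinders.
Variables (I : finType) (X : I -> {RV P >-> R}).

(** The sigma-algebra generated by the X i with i in J is encoded by this
pi-system; measurability with respect to it is measurability on the type
[g_sigma_algebraType (cylinder J)], so closure lemmas for measurable functions
apply directly. *)
Definition cylinder (J : {set I}) : set (set T) :=
  [set C | exists2 A : I -> set R, (forall i, measurable (A i)) &
           C = \bigcap_(i in [set` J]) X i @^-1` A i].

Lemma cylinder_measurable J : cylinder J `<=` measurable.
Proof.
move=> _ [A mA ->]; apply: fin_bigcap_measurable => // i _.
exact: measurable_funPTI.
Qed.

Lemma cylinderI J : setI_closed (cylinder J).
Proof.
move=> _ _ [A mA ->] [B mB ->]; exists (fun i => A i `&` B i).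
  by move=> i; exact: measurableI.
by rewrite -bigcapI.
Qed.

Lemma cylinderT J : cylinder J setT.
Proof.
exists (fun=> setT) => //.
by apply/esym; rewrite -subTset => x _ i _.
Qed.

Lemma measurable_cylinder_coord (J : {set I}) i : i \in J ->
  measurable_fun setT (X i : g_sigma_algebraType (cylinder J) -> R).
Proof.
move=> iJ _ B mB; rewrite setTI; apply: sub_sigma_algebra.
exists (fun j => if j == i then B else setT).
  by move=> j; case: ifP.
apply/seteqP; split => [x Bx j _ /=|x /(_ i iJ) /=]; rewrite ?eqxx//.
by case: eqP => // ->.
Qed.

Hypothesis indX : mutually_independent X.

Lemma independent_cylinders (J K : {set I}) A B : [disjoint J & K]%B ->
  cylinder J A -> cylinder K B -> P (A `&` B) = P A * P B.
Proof.
move=> JK [A' mA ->] [B' mB ->].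
pose C i := if i \in J then A' i else B' i.
have CK i : i \in K -> C i = B' i.
  by move=> iK; rewrite /C (disjointFl JK).
have CJ i : i \in J -> C i = A' i by move=> iJ; rewrite /C iJ.
rewrite [X in P X](_ : _ = \bigcap_(i in [set` J :|: K]) X i @^-1` C i); last first.
  apply/seteqP; split => [x [xJ xK] i|x xJK].
    rewrite /= inE => /orP[iJ|iK] /=; first by rewrite CJ//; exact: xJ.
    by rewrite CK//; exact: xK.
  split=> i /= iJK.
    by move: (xJK i); rewrite /= inE iJK CJ// => /(_ isT).
  by move: (xJK i); rewrite /= inE iJK orbT CK// => /(_ isT).
rewrite !indX//; last by move=> i; rewrite /C; case: ifP.
rewrite (eq_bigl [predU J & K])/=; last by move=> i; rewrite !inE.
rewrite bigU//=; congr (_ * _).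
  by apply: eq_bigr => i iJ; rewrite CJ.
by apply: eq_bigr => i iK; rewrite CK.
Qed.

Context d1 d2 (S1 : measurableType d1) (S2 : measurableType d2).
Variables (J K : {set I}) (f : T -> S1) (g : T -> S2).
Hypothesis JK : [disjoint J & K]%B.
Hypothesis mf : measurable_fun setT (f : g_sigma_algebraType (cylinder J) -> S1).
Hypothesis mg : measurable_fun setT (g : g_sigma_algebraType (cylinder K) -> S2).

Lemma measurable_fun_cylinder d' (S : measurableType d') (L : {set I})
    (h : T -> S) :
  measurable_fun setT (h : g_sigma_algebraType (cylinder L) -> S) ->
  measurable_fun setT h.
Proof.
move=> mh _ B mB; have := mh measurableT _ mB.
by apply: smallest_sub; [exact: sigma_algebra_measurable|exact: cylinder_measurable].
Qed.

Lemma independent_preimages A B : measurable A -> measurable B ->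
  P (f @^-1` A `&` g @^-1` B) = P (f @^-1` A) * P (g @^-1` B).
Proof.
move=> mA mB; apply: (@independent_generated2 (cylinder J) (cylinder K)).
- exact: cylinder_measurable.
- exact: cylinderI.
- exact: cylinderT.
- exact: cylinder_measurable.
- exact: cylinderI.
- exact: cylinderT.
- by move=> C D; exact: independent_cylinders.
- by have := mf measurableT mA; rewrite setTI.
- by have := mg measurableT mB; rewrite setTI.
Qed.

(** The joint law of f and g is the product of their laws, so Tonelli's theorem
lets g be evaluated at an independent copy of the sample point. *)
Lemma independent_decoupling (Phi : S1 * S2 -> \bar R) :
  measurable_fun setT Phi -> (forall z, 0 <= Phi z) ->
  \int[P]_w Phi (f w, g w) = \int[P]_w \int[P]_w' Phi (f w, g w').
Proof.
move=> mPhi Phi0.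
have mf' : measurable_fun setT f := measurable_fun_cylinder mf.
have mg' : measurable_fun setT g := measurable_fun_cylinder mg.
have mfg : measurable_fun setT (fun w => (f w, g w)) by exact: measurable_fun_pair.
pose F : {mfun T >-> S1} := HB.pack f (isMeasurableFun.Build _ _ _ _ f mf').
pose Gm : {mfun T >-> S2} := HB.pack g (isMeasurableFun.Build _ _ _ _ g mg').
pose FG : {mfun T >-> (S1 * S2)%type} :=
  HB.pack (fun w => (f w, g w)) (isMeasurableFun.Build _ _ _ _ _ mfg).
have -> : \int[P]_w Phi (f w, g w) = \int[distribution P FG]_z Phi z.
  by rewrite ge0_integral_distribution.
rewrite -(eq_measure_integral (distribution P FG)
    (m1 := distribution P F \x distribution P Gm)); last first.
  move=> A mA _; apply: product_measure_unique => // B C mB mC.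
  exact: independent_preimages.
rewrite fubini_tonelli1// /fubini_F ge0_integral_distribution//=; last 2 first.
- exact: measurable_fun_fubini_tonelli_F.
- by move=> x; exact: integral_ge0.
apply: eq_integral => w _.
rewrite ge0_integral_distribution//.
exact: measurable_fun_pair2.
Qed.

End cylinders.
End independence.

(** * The quantile transform of a size-biased law *)

Section partial_mass.
Context d (T : measurableType d) (R : realType) (P : probability T R).
Variable Y : T -> R.

Definition mass_le (x : R) : R :=
  fine (\int[P]_(w in [set w | (Y w <= x)%R]) (Y w)%:E)%E.

Definition mass_lt (x : R) : R :=
  fine (\int[P]_(w in [set w | (Y w < x)%R]) (Y w)%:E)%E.

Definition mass_total : R := fine (\int[P]_w (Y w)%:E)%E.

(** The guard makes the quantile a measurable function on the whole line: at
[mass_total] and beyond, the infimum can be over the empty set. *)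
Definition mass_quantile (h : R) : R :=
  if 0 < h < mass_total then inf [set x | 0 <= x /\ h <= mass_le x] else 0.

(** The distribution function of the Y-weighted law, evaluated at Y and
randomized by U across its jumps. *)
Definition mass_transform (U : T -> R) (w : T) : R :=
  mass_lt (Y w) + U w * (mass_le (Y w) - mass_lt (Y w)).

End partial_mass.

Lemma measurable_EFin_inv d (T : measurableType d) (R : realType) (y : T -> R) :
  measurable_fun setT y -> (forall w, 0 <= y w) ->
  measurable_fun setT (fun w => ((y w)^-1)%:E).
Proof.
move=> my y0; apply/measurable_EFinP.
rewrite (_ : (fun _ => _) = fun w => (y w) `^ (-1)).
  exact: (measurableT_comp (measurable_powR _)).
by apply/funext => w; rewrite powR_inv1.
Qed.

Section quantile_transform.
Context d (T : measurableType d) (R : realType) (P : probability T R).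
Variable Y : T -> R.
Hypotheses (mY : measurable_fun setT Y) (Y0 : forall w, 0 <= Y w).
Hypothesis iY : P.-integrable setT (EFin \o Y).

(** Size-biasing: P weighted by Y. The value 0 has no mass, so [mass_le] is the
function G of the reciprocating function, an expectation over 0 < Y <= x. *)
Let nu : {measure set T -> \bar R} := density_measure P mY Y0.
Let Yle x := [set w | Y w <= x].
Let Ylt x := [set w | Y w < x].

Local Notation G := (mass_le P Y).
Local Notation Gl := (mass_lt P Y).
Local Notation m := (mass_total P Y).

Let mYle x : measurable (Yle x).
Proof.
rewrite /Yle -[X in measurable X]setTI; exact: measurable_fun_ler.
Qed.

Let mYlt x : measurable (Ylt x).
Proof.
rewrite /Ylt -[X in measurable X]setTI; exact: measurable_fun_ltr.
Qed.

Let mYeq x : measurable [set w | Y w = x].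
Proof.
have -> : [set w | Y w = x] = Y @^-1` [set x] by [].
by rewrite -[X in measurable X]setTI; exact: mY.
Qed.

Let nuT : (nu setT < +oo)%E.
Proof.
have /integrableP[_] := iY; rewrite /nu/= /density_measure; apply: le_lt_trans.
apply: ge0_le_integral => //.
- by move=> x _; rewrite lee_fin.
- exact/measurable_EFinP.
- by apply/measurable_EFinP; exact: measurableT_comp.
- by move=> x _; rewrite lee_fin ler_norm.
Qed.

Let nu_fin A : measurable A -> nu A \is a fin_num.
Proof.
move=> mA; rewrite ge0_fin_numE//; apply: le_lt_trans nuT.
by apply: le_measure; rewrite ?inE.
Qed.

Let GE x : (G x)%:E = nu (Yle x).
Proof. by apply: fineK; exact: (nu_fin (mYle x)). Qed.

Let GlE x : (Gl x)%:E = nu (Ylt x).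
Proof. by apply: fineK; exact: (nu_fin (mYlt x)). Qed.

Let mE : m%:E = nu setT.
Proof. by apply: fineK; exact: (nu_fin measurableT). Qed.

Let nu_pos A : measurable A -> A `<=` [set w | Y w = 0] -> nu A = 0%E.
Proof.
move=> mA A0; rewrite /nu /= /density_measure integral0_eq// => w Aw.
by rewrite (A0 w Aw).
Qed.

Lemma mass_le_ge0 x : 0 <= G x.
Proof. by rewrite -lee_fin GE measure_ge0. Qed.

Lemma mass_lt_ge0 x : 0 <= Gl x.
Proof. by rewrite -lee_fin GlE measure_ge0. Qed.

Lemma mass_total_ge0 : 0 <= m.
Proof. by rewrite -lee_fin mE measure_ge0. Qed.

Lemma mass_le_le_total x : G x <= m.
Proof. by rewrite -lee_fin GE mE le_measure ?inE. Qed.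

Lemma mass_lt_le x : Gl x <= G x.
Proof. by rewrite -lee_fin GlE GE le_measure ?inE// => w /= /ltW. Qed.

Lemma mass_le_lt x y : x < y -> G x <= Gl y.
Proof.
move=> xy; rewrite -lee_fin GlE GE le_measure ?inE// =>
  w /= h; exact: le_lt_trans xy.
Qed.

Lemma mass_le_nd : {homo G : x y / x <= y}.
Proof.
move=> x y xy; rewrite -lee_fin !GE le_measure ?inE// => w /= h; exact: le_trans xy.
Qed.

Lemma mass_lt_nd : {homo Gl : x y / x <= y}.
Proof.
move=> x y xy; rewrite -lee_fin !GlE le_measure ?inE// =>
  w /= h; exact: lt_le_trans xy.
Qed.

Lemma mass_le0 x : x <= 0 -> G x = 0.
Proof.
move=> x0; apply: EFin_inj; rewrite GE nu_pos// => w /= Yw.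
by apply/eqP; rewrite eq_le Y0 (le_trans Yw).
Qed.

Let nu_ndE (F : (set T)^nat) e : (forall n, measurable (F n)) ->
  nondecreasing_seq F -> 0 < e ->
  exists n, fine (nu (\bigcup_n F n)) - e < fine (nu (F n)).
Proof.
move=> mF ndF e0; apply: contrapT => /forallNP H.
have mU : measurable (\bigcup_n F n) by exact: bigcupT_measurable.
have := @nondecreasing_cvg_mu _ _ _ nu F mF mU ndF.
move=> /cvge_to_le h.
have : (nu (\bigcup_n F n) <= (fine (nu (\bigcup_n F n)) - e)%:E)%E.
  apply: h; apply: nearW => n /=; rewrite -(fineK (nu_fin (mF n))) lee_fin leNgt.
  exact/negP.
rewrite -{1}(fineK (nu_fin mU)) lee_fin.
by rewrite lerBrDr gerDl leNgt e0.
Qed.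

Let nu_niE (F : (set T)^nat) e : (forall n, measurable (F n)) ->
  nonincreasing_seq F -> 0 < e ->
  exists n, fine (nu (F n)) < fine (nu (\bigcap_n F n)) + e.
Proof.
move=> mF niF e0; apply: contrapT => /forallNP H.
have mU : measurable (\bigcap_n F n) by exact: bigcapT_measurable.
have F0 : (nu (F 0%N) < +oo)%E by rewrite -ge0_fin_numE// nu_fin.
have := @nonincreasing_cvg_mu _ _ _ nu F F0 mF mU niF.
move=> /cvge_to_ge  h.
have : ((fine (nu (\bigcap_n F n)) + e)%:E <= nu (\bigcap_n F n))%E.
  apply: h; apply: nearW => n /=; rewrite -(fineK (nu_fin (mF n))) lee_fin leNgt.
  exact/negP.
by rewrite -{2}(fineK (nu_fin mU)) lee_fin gerDl leNgt e0.
Qed.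

Lemma mass_le_left x e : 0 < e -> exists2 y, y < x & Gl x - e < G y.
Proof.
move=> e0; pose F n := Yle (x - n.+1%:R^-1).
have ndF : nondecreasing_seq F.
  move=> i j ij; apply/subsetPset => w /= /le_trans; apply.
  by rewrite lerD2l lerN2 lef_pV2 ?posrE// ler_nat.
have [n] := nu_ndE (fun n => mYle _) ndF e0.
have -> : \bigcup_n F n = Ylt x.
  apply/seteqP; split => [w [k _ /= wk]|w /= wx].
    by rewrite /Ylt /= (le_lt_trans wk)// gtrDl oppr_lt0.
  have [k wk] := ltr_add_invr wx.
  by exists k => //=; rewrite /F /Yle /= lerBrDr ltW.
move=> h; exists (x - n.+1%:R^-1) => //.
by rewrite gtrDl oppr_lt0.
Qed.

Lemma mass_le_right x e : 0 < e -> exists2 y, x < y & G y < G x + e.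
Proof.
move=> e0; pose F n := Yle (x + n.+1%:R^-1).
have niF : nonincreasing_seq F.
  move=> i j ij; apply/subsetPset => w /= /le_trans; apply.
  by rewrite lerD2l lef_pV2 ?posrE// ler_nat.
have [n] := nu_niE (fun n => mYle _) niF e0.
have -> : \bigcap_n F n = Yle x.
  apply/seteqP; split => [w /= wF|w /= wx k _].
    rewrite /Yle /= leNgt; apply/negP => xw.
    have [k wk] := ltr_add_invr xw.
    by have := wF k Logic.I; rewrite /F /Yle /= leNgt wk.
  by rewrite /F /Yle /= (le_trans wx)// lerDl.
by move=> h; exists (x + n.+1%:R^-1) => //; rewrite ltrDl.
Qed.

Lemma mass_le_top h : h < m -> exists2 x, 0 <= x & h < G x.
Proof.
rewrite -subr_gt0 => e0; pose F n := Yle n%:R.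
have ndF : nondecreasing_seq F.
  move=> i j ij; apply/subsetPset => w /= /le_trans; apply.
  by rewrite ler_nat.
have [n] := nu_ndE (fun n => mYle _) ndF e0.
have -> : \bigcup_n F n = setT.
  rewrite -subTset => w _; exists (Num.truncn (Y w)).+1 => //=.
  by rewrite /F /Yle /= ltW// truncnS_gt.
by rewrite -/m opprB addrCA subrr addr0 => hn; exists n%:R.
Qed.

Let nu_atom x B : measurable B ->
  nu ([set w | Y w = x] `&` B) = (x%:E * P ([set w | Y w = x] `&` B))%E.
Proof.
move=> mB; rewrite /nu /= /density_measure.
rewrite -integral_cst//; last exact: measurableI.
by apply: eq_integral => w; rewrite inE => -[/= Yw _] /=; rewrite Yw.
Qed.

Let massE x : nu [set w | Y w = x] = (G x - Gl x)%:E.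
Proof.
rewrite EFinB GE GlE.
have -> : Yle x = Ylt x `|` [set w | Y w = x].
  apply/seteqP; split => w; rewrite /Yle /Ylt /=.
    by rewrite le_eqVlt => /predU1P[|]; [right|left].
  by move=> [/ltW|->].
rewrite measureU//; last first.
  by rewrite -subset0 => w [] /= + Yw; rewrite /Ylt /= Yw ltxx.
rewrite [X in (_ = X - _)%E]addeC addeK//; exact: (nu_fin (mYlt x)).
Qed.

(** A jump of the mass is an atom of Y, so off the atoms the randomization in
[mass_transform] has no effect. *)
Lemma mass_jump x : ((G x - Gl x)%:E = x%:E * P [set w | Y w = x])%E.
Proof. by rewrite -massE -[X in nu X]setIT nu_atom ?setIT. Qed.

Variable U : T -> R.
Hypotheses (mU : measurable_fun setT U) (U01 : forall w, 0 <= U w <= 1).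
Hypothesis YU : forall x t, 0 <= t <= 1 ->
  P ([set w | Y w = x] `&` [set w | U w <= t]) = (P [set w | Y w = x] * t%:E)%E.

Local Notation V := (mass_transform P Y U).

Lemma measurable_mass_transform : measurable_fun setT V.
Proof.
have mG : measurable_fun setT (fun w => G (Y w)).
  apply: (measurableT_comp _ mY); exact: (nondecreasing_measurable _ mass_le_nd).
have mGl : measurable_fun setT (fun w => Gl (Y w)).
  apply: (measurableT_comp _ mY); exact: (nondecreasing_measurable _ mass_lt_nd).
apply: measurable_funD => //; apply: measurable_funM => //.
exact: measurable_funB.
Qed.

Lemma mass_transform_ge w : Gl (Y w) <= V w.
Proof.
by rewrite lerDl mulr_ge0 ?subr_ge0 ?mass_lt_le//; have /andP[] := U01 w.
Qed.

Lemma mass_transform_le w : V w <= G (Y w).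
Proof.
rewrite -lerBrDl ler_piMl ?subr_ge0 ?mass_lt_le//.
by have /andP[] := U01 w.
Qed.

Lemma mass_transform_ge0 w : 0 <= V w.
Proof. exact: le_trans (mass_lt_ge0 _) (mass_transform_ge w). Qed.

Let mVle h : measurable [set w | V w <= h].
Proof.
rewrite -[X in measurable X]setTI; apply: measurable_fun_ler => //.
exact: measurable_mass_transform.
Qed.

(** Let b be the largest point with mass at most h below it. Where Y < b the
transform is at most h, and where Y > b it is greater than h. On Y = b the
uniform variable selects exactly the fraction (h - Gl b) / (G b - Gl b) of the
atom. *)
Lemma mass_transform_law h : 0 <= h <= m -> nu [set w | V w <= h] = h%:E.
Proof.
move=> /andP[h0]; rewrite le_eqVlt => /predU1P[->|hm].
  rewrite mE; congr (nu _); apply/seteqP; split => // w _ /=.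
  exact: le_trans (mass_transform_le w) (mass_le_le_total _).
pose S := [set x | 0 <= x /\ G x <= h]; pose b := sup S.
have S0 : S 0 by split => //; rewrite mass_le0.
have [t t0 ht] := mass_le_top hm.
have hS : has_sup S.
  split; first by exists 0.
  exists t => x [x0 Gx]; rewrite leNgt; apply/negP => tx.
  by have := lt_le_trans ht (mass_le_nd (ltW tx)); rewrite ltNge Gx.
have b0 : 0 <= b by exact: sup_upper_bound.
have ltb x : x < b -> G x <= h.
  rewrite -subr_gt0 => xb; have [y [y0 Gy]] := sup_adherent xb hS.
  rewrite opprB addrCA subrr addr0 => xy.
  exact: le_trans (mass_le_nd (ltW xy)) Gy.
have gtb x : b < x -> h < G x.
  move=> bx; rewrite ltNge; apply/negP => Gx.
  have : S x by split => //; rewrite (le_trans b0)// ltW.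
  by move=> /(sup_upper_bound hS); rewrite leNgt bx.
have Glb : Gl b <= h.
  rewrite leNgt; apply/negP; rewrite -subr_gt0 => /(mass_le_left b)[y yb].
  by rewrite opprB addrCA subrr addr0 ltNge ltb.
have Gb : h <= G b.
  rewrite leNgt; apply/negP; rewrite -subr_gt0 => /(mass_le_right b)[y yb].
  by rewrite addrCA subrr addr0 ltNge ltW// gtb.
have -> : [set w | V w <= h] =
    Ylt b `|` ([set w | Y w = b] `&` [set w | V w <= h]).
  apply/seteqP; split => w /=; rewrite /Ylt /=.
    move=> Vh; have [Yb|Yb|->] := ltgtP (Y w) b; [by left| |by right].
    exfalso; move: Vh; apply/negP; rewrite -ltNge.
    apply: lt_le_trans (mass_transform_ge w).
    have [c /andP[bc cY]] : exists c, b < c < Y w.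
      by exists ((b + Y w) / 2); rewrite midf_lt//= midf_lt.
    exact: lt_le_trans (gtb _ bc) (mass_le_lt cY).
  move=> [Yb|[]//]; exact: le_trans (mass_transform_le w) (ltb _ Yb).
have mE1 : measurable ([set w | Y w = b] `&` [set w | V w <= h]).
  exact: measurableI.
rewrite measureU//; last first.
  by rewrite -subset0 => w [] /= + [Yw _]; rewrite /Ylt /= Yw ltxx.
rewrite [X in (X + _)%E = _](_ : _ = (Gl b)%:E); last by rewrite GlE.
have : Gl b <= G b by exact: mass_lt_le.
rewrite le_eqVlt => /predU1P[GlGb|GlGb].
  rewrite [X in (_ + X)%E](_ : _ = 0%E).
    by rewrite adde0; congr EFin; apply/eqP; rewrite eq_le Glb GlGb Gb.
  apply/eqP; rewrite eq_le measure_ge0 andbT.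
  rewrite (@le_trans _ _ (nu [set w | Y w = b]))//.
    by rewrite le_measure ?inE// => w [].
  by rewrite massE GlGb subrr.
pose t' := (h - Gl b) / (G b - Gl b).
have J0 : 0 < G b - Gl b by rewrite subr_gt0.
have t'01 : 0 <= t' <= 1.
  rewrite divr_ge0 ?subr_ge0 ?(ltW GlGb)//=.
  by rewrite ler_pdivrMr// mul1r lerB.
have -> : [set w | Y w = b] `&` [set w | V w <= h] =
    [set w | Y w = b] `&` [set w | U w <= t'].
  apply/seteqP; split => w [/= Yb]; rewrite /mass_transform Yb => H; split => //.
    by rewrite /= ler_pdivlMr// lerBrDl.
  by move: H; rewrite /= ler_pdivlMr// lerBrDl.
rewrite [X in (_ + X)%E](_ : _ = (h - Gl b)%:E).
  by rewrite -EFinD addrCA subrr addr0.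
have mUt : measurable [set w | U w <= t'].
  by rewrite -[X in measurable X]setTI; exact: measurable_fun_ler.
have bP : (b%:E * P [set w | Y w = b])%E = (G b - Gl b)%:E.
  rewrite -massE; have := nu_atom b measurableT; rewrite setIT => h'.
  exact/esym.
apply: (etrans (nu_atom b mUt)); rewrite YU// muleA bP.
by rewrite -EFinM /t' mulrCA divff ?gt_eqF// mulr1.
Qed.

(** The infimum is attained, by right-continuity of [mass_le]. *)
Lemma mass_quantileP h x : 0 < h < m ->
  (mass_quantile P Y h <= x) = (0 <= x) && (h <= G x).
Proof.
move=> h0m; rewrite /mass_quantile h0m; case/andP: h0m => h0 hm.
set S := [set x | 0 <= x /\ h <= G x].
have [t t0 ht] := mass_le_top hm.
have hi : has_inf S.
  by split; [exists t; split => //; exact: ltW|exists 0 => x' []].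
have q0 : 0 <= inf S by apply: lb_le_inf; [case: hi|move=> x' []].
have Gq : h <= G (inf S).
  rewrite leNgt; apply/negP; rewrite -subr_gt0 => /(mass_le_right (inf S))[y].
  rewrite -subr_gt0 => /inf_adherent => /(_ _ hi)[z [z0 hz]].
  rewrite addrCA subrr addr0 => zy; rewrite addrCA subrr addr0 => Gy.
  by have := le_lt_trans (mass_le_nd (ltW zy)) Gy; rewrite ltNge hz.
apply/idP/idP => [qx|/andP[x0 hx]].
  by rewrite (le_trans q0 qx) (le_trans Gq)// mass_le_nd.
by apply: ge_inf => //; case: hi.
Qed.

Lemma mass_quantile_gt0 h : 0 < h < m -> 0 < mass_quantile P Y h.
Proof.
move=> h0m; rewrite ltNge mass_quantileP// lexx/= mass_le0// -ltNge.
by case/andP: h0m.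
Qed.

Lemma mass_quantile_ge0 h : 0 <= mass_quantile P Y h.
Proof.
have [/mass_quantile_gt0/ltW//|hD] := boolP (0 < h < m).
by rewrite /mass_quantile (negbTE hD).
Qed.

Let D := `]0, m[%classic : set R.

Lemma measurable_mass_quantile : measurable_fun setT (mass_quantile P Y).
Proof.
have mD : measurable D by exact: measurable_itv.
rewrite (_ : mass_quantile P Y = mass_quantile P Y \_ D); last first.
  apply/funext => h; rewrite patchE; case: ifPn => //.
  by rewrite notin_setE /D /= in_itv/= /mass_quantile => /negP/negbTE ->.
apply/(measurable_restrictT _ mD).
apply: (measurability _ (RGenOInfty.measurableE R)).
move=> _ [_ [x ->] <-].
rewrite (_ : _ `&` _ = D `&` (if x < 0 then setT else `]G x, +oo[%classic)).
  by case: ifPn => _; exact: measurableI.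
have qx h : D h -> (x < mass_quantile P Y h) = (x < 0) || (G x < h).
  rewrite /D /= in_itv/= => hD.
  by rewrite ltNge mass_quantileP// negb_and -!ltNge.
apply/seteqP; split => h /= [Dh]; rewrite in_itv/= andbT.
  rewrite qx// => xh; split => //; move: xh.
  by case: ifPn => //= _; rewrite in_itv/= andbT.
move=> xh; split => //; rewrite qx//; move: xh.
by case: ifPn => //= _; rewrite in_itv/= andbT.
Qed.

Let measurable_rays (A : set R) : measurable A ->
  <<s [set `]-oo, x]%classic | x in [set: R]] >> A.
Proof.
apply: smallest_sub; first exact: smallest_sigma_algebra.
move=> _ [[a b] _ <-] /=.
have -> : `]a, b]%classic = `]-oo, b]%classic `\` `]-oo, a]%classic :> set R.
  apply/seteqP; split => x /=; rewrite !in_itv/= ltNge.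
    by move=> /andP[/negP].
  by move=> [-> /negP ->].
pose GT := g_sigma_algebraType [set `]-oo, x]%classic | x in [set: R]].
by apply: (@measurableD _ GT); apply: sub_sigma_algebra; eexists.
Qed.

Let lebesgue_ray (x : R) : 0 <= m ->
  lebesgue_measure (`]-oo, x]%classic `&` `[0, m]%classic) =
  (if x < 0 then 0 else if x < m then x else m)%:E.
Proof.
move=> m0; case: ltP => x0.
  rewrite (_ : _ `&` _ = set0) ?measure0// -subset0 => y /= [].
  rewrite !in_itv/= => yx /andP[y0 _].
  by have := le_lt_trans (le_trans y0 yx) x0; rewrite ltxx.
rewrite (_ : _ `&` _ = `[0, if x < m then x else m]%classic).
  rewrite lebesgue_measure_itv/= lte_fin -EFinD oppr0 addr0.
  case: ltP => //; case: ltP => xm h; apply/eqP; rewrite eqe eq_le.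
    by rewrite h x0.
  by rewrite h m0.
apply/seteqP; split => y /=; rewrite !in_itv/=; case: ltP => xm.
- by move=> [-> /andP[->]].
- by move=> [_ ->].
- by move=> /andP[-> yx]; rewrite yx (le_trans yx)// ltW.
- by move=> /andP[-> ym]; rewrite ym (le_trans ym).
Qed.

Lemma mass_transform_pushforward (A : set R) : measurable A ->
  nu (V @^-1` A) = lebesgue_measure (A `&` `[0, m]%classic).
Proof.
move=> mA.
have mD : measurable (`[0, m]%classic : set R) by [].
have mV := measurable_mass_transform.
have [m1 m1E] : exists m1 : {measure set (measurableTypeR R) -> \bar R},
    forall A, m1 A = nu (V @^-1` A).
  by unshelve eexists (pushforward nu (V : T -> measurableTypeR R) :
    {measure set (measurableTypeR R) -> \bar R}).
pose m2 : {measure set (measurableTypeR R) -> \bar R} :=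
  mrestr (@lebesgue_measure R) mD.
have Gm : [set `]-oo, x]%classic | x in [set: R]] `<=`
    (measurable : set (set R)).
  by move=> _ [x _ <-].
rewrite -m1E -[RHS]/(m2 A).
apply: (@g_sigma_algebra_measure_unique _ R (measurableTypeR R)
  [set `]-oo, x]%classic | x in [set: R]] Gm (fun n => `]-oo, n%:R]%classic)) => //.
- rewrite -subTset => x _; exists (Num.truncn x).+1 => //=.
  by rewrite in_itv/= ltW// truncnS_gt.
- move=> _ _ [x _ <-] [y _ <-]; exists (Num.min x y) => //.
  by apply/seteqP; split => z /=; rewrite !in_itv/= le_min => /andP.
- move=> _ [x _ <-].
  rewrite [RHS]lebesgue_ray ?mass_total_ge0//.
  have -> : m1 `]-oo, x]%classic = nu [set w | V w <= x].
    by rewrite m1E; congr (nu _); apply/seteqP; split => w /=; rewrite in_itv.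
  case: ltP => x0.
    rewrite (_ : [set w | _] = set0) ?measure0// -subset0 => w /= Vx.
    have := le_lt_trans (le_trans (mass_transform_ge0 w) Vx) x0.
    by rewrite ltxx.
  case: ltP => xm; first by rewrite mass_transform_law// x0 ltW.
  rewrite mE; congr (nu _); apply/seteqP; split => // w _ /=.
  by rewrite (le_trans (mass_transform_le w))// (le_trans (mass_le_le_total _)).
- move=> n; rewrite m1E -ge0_fin_numE//; apply: nu_fin.
  by rewrite -[X in measurable X]setTI; exact: mV.
- exact: measurable_rays.
Qed.

(** That Y is the quantile of V needs no case analysis on atoms or flat parts of
G. The quantile is at most Y because V <= G (Y). If it were smaller, some
rational r would lie in between, so that V <= G r but Y > r; and Y <= r implies
V <= G r, while both events have nu-mass G r by the law of V. *)
Let nu_null : exists N : set T, [/\ measurable N, nu N = 0%E &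
  forall w, ~ N w -> D (V w) /\ Y w = mass_quantile P Y (V w)].
Proof.
have mV := measurable_mass_transform.
have mDc : measurable (~` D) by apply: measurableC; exact: measurable_itv.
pose N1 := V @^-1` (~` D).
have mN1 : measurable N1.
  rewrite /N1 -[X in measurable X]setTI; exact: mV.
have nuN1 : nu N1 = 0%E.
  rewrite mass_transform_pushforward//.
  have mm : measurable ([set 0; m] : set R) by exact: measurableU.
  apply/eqP; rewrite eq_le measure_ge0 andbT.
  rewrite -(@countable_lebesgue_measure0 _ ([set 0; m] : set R)); last first.
    by apply: finite_set_countable; exact: finite_set2.
  rewrite le_measure ?inE//; first exact: measurableI.
  move=> x [/= Dx]; rewrite in_itv/= => /andP[x0 xm].
  apply: contrapT => /not_orP[xN0 xNm]; apply: Dx; rewrite /D/= in_itv/=.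
  by rewrite !lt_neqAle x0 xm !andbT eq_sym; apply/andP; split; apply/eqP.
pose r_ (n : nat) : R := if @unpickle rat n is Some q then ratr q else 0.
pose N2 n := [set w | V w <= G (r_ n)] `\` Yle (r_ n).
have mN2 n : measurable (N2 n) by exact: measurableD.
have nuN2 n : nu (N2 n) = 0%E.
  have GrI : 0 <= G (r_ n) <= m by rewrite mass_le_ge0 mass_le_le_total.
  have mD : measurable [set w | V w <= G (r_ n)] by [].
  have -> : nu (N2 n) = (nu [set w | (V w <= G (r_ n))%R] - nu (Yle (r_ n)))%E.
    rewrite /N2 measureD//; last by apply: le_lt_trans nuT; rewrite le_measure ?inE.
    congr (_ - nu _)%E; apply: setIidr => w /= Yr.
    exact: le_trans (mass_transform_le w) (mass_le_nd Yr).
  by rewrite mass_transform_law// -GE subee.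
exists (N1 `|` \bigcup_n N2 n); split.
- by apply: measurableU => //; exact: bigcupT_measurable.
- apply/negligibleP.
    by apply: measurableU => //; exact: bigcupT_measurable.
  apply: negligibleU; first exact/negligibleP.
  apply: negligible_bigcup => n; apply/negligibleP; [exact: mN2|exact: nuN2].
move=> w /not_orP[N1w N2w].
have DV : D (V w) by apply: contrapT => DVw; exact: N1w.
split => //; have V0m : 0 < V w < m by move: DV; rewrite /D /= in_itv.
apply/eqP; rewrite eq_le andbC mass_quantileP// Y0 mass_transform_le/=.
rewrite leNgt; apply/negP => /rat_in_itvoo[r]; rewrite in_itv/= => /andP[qr rY].
apply: N2w; exists (pickle r) => //; rewrite /N2 /r_ pickleK/=; split.
  by move: (ltW qr); rewrite mass_quantileP// => /andP[].
by rewrite /Yle /= leNgt rY.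
Qed.

(** Dividing the integrand by Y turns P on Y > 0 into [nu]; under [nu], V has
Lebesgue measure on ]0, m[ as its law and Y is its quantile. *)
Lemma quantile_transform_integral (F : R * R -> \bar R) :
  measurable_fun setT F -> (forall z, 0 <= F z)%E ->
  (\int[P]_(w in [set w | (0 < Y w)%R]) F (Y w, V w) =
   \int[lebesgue_measure]_(h in `]0%R, m[)
     (F (mass_quantile P Y h, h) * ((mass_quantile P Y h)^-1)%:E))%E.
Proof.
move=> mF F0; have mV := measurable_mass_transform.
have mD : measurable D by exact: measurable_itv.
set q := mass_quantile P Y.
have mq : measurable_fun setT q by exact: measurable_mass_quantile.
have q0 h : 0 <= q h by exact: mass_quantile_ge0.
have [N [mN nuN Ngood]] := nu_null.
pose H h := (F (q h, h) * ((q h)^-1)%:E)%E.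
have mH : measurable_fun setT H.
  apply: emeasurable_funM; last exact: measurable_EFin_inv.
  by apply: (measurableT_comp mF); exact: measurable_fun_pair.
have H0 h : (0 <= H h)%E by rewrite mule_ge0// lee_fin invr_ge0.
transitivity (\int[nu]_w (F (Y w, V w) * ((Y w)^-1)%:E))%E.
  rewrite ge0_integral_density; last 2 first.
  - apply: emeasurable_funM; last exact: measurable_EFin_inv.
    by apply: (measurableT_comp mF); exact: measurable_fun_pair.
  - by move=> w; rewrite mule_ge0// lee_fin invr_ge0.
  rewrite [LHS]integral_mkcond; apply: eq_integral => w _; rewrite patchE.
  case: ifPn => [|]; rewrite ?inE ?notin_setE /= => Yw.
    by rewrite -muleA -EFinM mulVf ?mule1// gt_eqF.
  have -> : Y w = 0 by apply/eqP; rewrite eq_le Y0 andbT leNgt; exact/negP.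
  by rewrite mule0.
transitivity (\int[nu]_(w in V @^-1` D) H (V w))%E.
  have mVD : measurable (V @^-1` D).
    by rewrite -[X in measurable X]setTI; exact: mV.
  rewrite (@ge0_negligible_integral _ _ _ nu _ N)//; last 2 first.
  - apply: emeasurable_funM; last exact: measurable_EFin_inv.
    by apply: (measurableT_comp mF); exact: measurable_fun_pair.
  - by move=> w _; rewrite mule_ge0// lee_fin invr_ge0.
  rewrite [RHS](@ge0_negligible_integral _ _ _ nu _ N)//; last first.
    by apply: measurable_funTS; exact: measurableT_comp.
  rewrite (_ : V @^-1` D `\` N = setT `\` N).
    apply: eq_integral => w /[!inE] -[_ /Ngood[DV YV]].
    by rewrite /H /q -YV.
  by apply/seteqP; split => w [] // _ Nw; split => //; have [] := Ngood w Nw.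
rewrite -[LHS](@ge0_integral_pushforward _ _ _ (measurableTypeR R) _ V mV nu D H)//.
  apply: eq_measure_integral => A mA AD.
  rewrite [LHS]mass_transform_pushforward// setIidl// => x /AD.
  by rewrite /D /= !in_itv/= => /andP[/ltW -> /ltW].
exact: measurable_funTS.
Qed.

(** At the ends of [0, m], x_plus and x_minus may be infinite or zero; they are
avoided because Lebesgue measure has no atoms. *)
Lemma mass_transform_itv_ae :
  P ([set w | 0 < Y w] `&` [set w | ~~ (0 < V w < m)]) = 0%E.
Proof.
have mV := measurable_mass_transform.
pose B : set R := ~` `]0, m[%classic.
have mB : measurable B by apply: measurableC; exact: measurable_itv.
have mS : measurable (snd @^-1` B : set (R * R)).
  by rewrite -[X in measurable X]setTI; exact: measurable_snd.
have mVB : measurable (V @^-1` B).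
  by rewrite -[X in measurable X]setTI; exact: mV.
have mY0 : measurable [set w | 0 < Y w].
  by rewrite -[X in measurable X]setTI; exact: measurable_fun_ltr.
have -> : [set w | ~~ (0 < V w < m)] = V @^-1` B.
  by apply/seteqP; split => w /=; rewrite /B /= in_itv/= => /negP.
have := @quantile_transform_integral (fun z => (\1_(snd @^-1` B) z)%:E).
rewrite [X in _ -> _ -> _ = X]integral0_eq; last first.
  by move=> h hD; rewrite indicE memNset ?mul0e// => /(_ hD).
move=> <-//; last by apply/measurable_EFinP; exact: measurable_indic.
by rewrite setIC -integral_indic.
Qed.

End quantile_transform.

(** * The reciprocating function in terms of size-biased masses *)

Section reciprocating_function_mass.
Context d (T : measurableType d) (R : realType) (P : probability T R).
Variable X : {RV P >-> R}.
Hypothesis zX : zero_mean X.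

Local Notation Xp := (funrpos X).
Local Notation Xn := (funrneg X).

Let mXp : measurable_fun setT Xp. Proof. exact: measurable_funrpos. Qed.
Let mXn : measurable_fun setT Xn. Proof. exact: measurable_funrneg. Qed.
Let Xp0 w : 0 <= Xp w. Proof. exact: funrpos_ge0. Qed.
Let Xn0 w : 0 <= Xn w. Proof. exact: funrneg_ge0. Qed.
Let iXp : P.-integrable setT (EFin \o Xp).
Proof. by apply: integrable_funrpos => //; case: zX. Qed.
Let iXn : P.-integrable setT (EFin \o Xn).
Proof. by apply: integrable_funrneg => //; case: zX. Qed.

(** The only place where E X = 0 enters. *)
Lemma mass_total_posneg : mass_total P Xn = mass_total P Xp.
Proof.
have [_] := zX; rewrite unlock integralE.
have -> : (\int[P]_w ((fun w => (X w)%:E)^\+)%E w = \int[P]_w (Xp w)%:E)%E.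
  by apply: eq_integral => w _; rewrite funeposE /funrpos EFin_max.
have -> : (\int[P]_w ((fun w => (X w)%:E)^\-)%E w = \int[P]_w (Xn w)%:E)%E.
  by apply: eq_integral => w _; rewrite funenegE /funrneg EFin_max.
rewrite /mass_total => h.
have fp : (\int[P]_w (Xp w)%:E)%E \is a fin_num by exact: integrable_fin_num.
have fn : (\int[P]_w (Xn w)%:E)%E \is a fin_num by exact: integrable_fin_num.
by congr fine; move/eqP: h; rewrite sube_eq ?add0e ?fin_num_adde_defr// => /eqP.
Qed.

Local Notation m := (mass_total P Xp).

Lemma recipG_ge0 x : 0 <= x -> recipG X x%:E = mass_le P Xp x.
Proof.
move=> x0; rewrite /recipG lee_fin x0 /mass_le unlock; congr fine.
rewrite [RHS]integral_mkcond; apply: eq_integral => w _.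
rewrite patchE indicE /funrpos; case: ifPn => [|]; rewrite ?inE ?notin_setE /=.
  move=> Xx; have [X0|X0] := leP (X w) 0.
    by rewrite memNset ?mulr0//= => -[]; rewrite ltNge X0.
  by rewrite mem_set ?mulr1//= lee_fin; split => //; move: Xx; rewrite max_l// ltW.
by move=> Xx; rewrite memNset ?mulr0//= lee_fin => -[X0 Xx']; apply: Xx;
  rewrite max_l// ltW.
Qed.

Lemma recipG_le0 x : x <= 0 -> recipG X x%:E = mass_le P Xn (- x).
Proof.
rewrite le_eqVlt => /predU1P[->|x0].
  by rewrite recipG_ge0// oppr0 !mass_le0.
rewrite /recipG lee_fin leNgt x0 /= /mass_le unlock; congr fine.
rewrite [RHS]integral_mkcond; apply: eq_integral => w _.
rewrite patchE indicE /funrneg; case: ifPn => [|]; rewrite ?inE ?notin_setE /=.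
  move=> Xx; have [X0|X0] := leP 0 (X w).
    by rewrite max_r ?oppr_le0// memNset ?mulr0//= => -[_]; rewrite ltNge X0.
  have Xx' : - X w <= - x by move: Xx; rewrite max_l// oppr_ge0 ltW.
  rewrite max_l; last by rewrite oppr_ge0 ltW.
  by rewrite mem_set ?mulr1//= lee_fin; split => //; rewrite -lerN2.
move=> Xx; rewrite memNset ?mulr0//= lee_fin => -[xX X0]; apply: Xx.
by rewrite max_l ?lerN2// oppr_ge0 ltW.
Qed.

Lemma recipG_left_gt0 x : 0 < x -> recipG_left X x = mass_lt P Xp x.
Proof.
move=> x0; apply/cvg_lim => //; apply/cvgrPdist_le => e e0.
have [y yx hy] := mass_le_left mXp Xp0 iXp x e0.
near=> z.
have zx : z < x by near: z; exact: nbhs_left_lt.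
have yz : y < z by near: z; exact: nbhs_left_gt.
have z0 : 0 < z by near: z; exact: nbhs_left_gt.
rewrite recipG_ge0 ?(ltW z0)// ger0_norm ?subr_ge0 ?mass_le_lt//.
by rewrite lerBlDl -lerBlDr (le_trans (ltW hy))// mass_le_nd// ltW.
Unshelve. all: by end_near. Qed.

(** The left limit at 0 is taken on the negative branch of G. *)
Lemma recipG_left0 : recipG_left X 0 = 0.
Proof.
apply/cvg_lim => //; apply/cvgrPdist_le => e e0.
have [y yx hy] := mass_le_right mXn Xn0 iXn 0 e0.
near=> z.
have z0 : z < 0 by near: z; exact: nbhs_left_lt.
have yz : - y < z by near: z; apply: nbhs_left_gt; rewrite oppr_lt0.
rewrite recipG_le0 ?(ltW z0)// sub0r normrN ger0_norm ?mass_le_ge0//.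
have h0 : mass_le P Xn 0 = 0 by exact: mass_le0.
rewrite h0 add0r in hy; apply: le_trans (ltW hy).
by rewrite mass_le_nd// lerNl ltW.
Unshelve. all: by end_near. Qed.

Lemma recipG_right_lt0 x : x < 0 -> recipG_right X x = mass_lt P Xn (- x).
Proof.
move=> x0; apply/cvg_lim => //; apply/cvgrPdist_le => e e0.
have [y yx hy] := mass_le_left mXn Xn0 iXn (- x) e0.
near=> z.
have zx : x < z by near: z; exact: nbhs_right_gt.
have yz : z < - y by near: z; apply: nbhs_right_lt; rewrite ltrNr.
have z0 : z < 0 by near: z; exact: nbhs_right_lt.
rewrite recipG_le0 ?(ltW z0)// ger0_norm; last first.
  by rewrite subr_ge0 mass_le_lt// ltrN2.
by rewrite lerBlDl -lerBlDr (le_trans (ltW hy))// mass_le_nd// lerNr ltW.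
Unshelve. all: by end_near. Qed.

Lemma x_plusE h : 0 < h < m -> x_plus X h = (mass_quantile P Xp h)%:E.
Proof.
move=> hm; have qP := mass_quantileP mXp Xp0 iXp _ hm.
apply/eqP; rewrite eq_le; apply/andP; split.
  apply: ereal_inf_lbound; have := qP (mass_quantile P Xp h).
  rewrite lexx => /esym/andP[q0 hq]; split; first by rewrite lee_fin.
  by rewrite recipG_ge0.
apply: le_ereal_inf_tmp => -[x [] /= x0 hx|_|[]//]; last by rewrite leey.
by rewrite lee_fin qP -lee_fin x0/= -recipG_ge0.
Qed.

Lemma x_minusE h : 0 < h < m -> x_minus X h = (- mass_quantile P Xn h)%:E.
Proof.
rewrite -mass_total_posneg => hm; have qP := mass_quantileP mXn Xn0 iXn _ hm.
apply/eqP; rewrite eq_le; apply/andP; split; last first.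
  apply: ereal_sup_ubound; have := qP (mass_quantile P Xn h).
  rewrite lexx => /esym/andP[q0 hq]; split; first by rewrite lee_fin oppr_le0.
  by rewrite recipG_le0 ?oppr_le0// opprK.
apply: ge_ereal_sup => -[x [] /= x0 hx|[]//|_]; last by rewrite leNye.
by rewrite lee_fin lerNr qP oppr_ge0 -lee_fin x0/= -recipG_le0.
Qed.

Lemma x_minus0 : x_minus X 0 = 0%E.
Proof.
apply/eqP; rewrite eq_le; apply/andP; split.
  by apply: ge_ereal_sup => x [].
by apply: ereal_sup_ubound; split => //=; rewrite recipG_ge0// mass_le0.
Qed.

End reciprocating_function_mass.

(** * Uniform variables *)

Section uniform.
Context (R : realType).

(** A uniform variable is in [0, 1] only almost surely; clipping it gives a
version for which the bounds hold everywhere. *)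
Definition clip01 (u : R) : R := Num.max 0 (Num.min 1 u).

Lemma clip01_itv u : 0 <= clip01 u <= 1.
Proof. by rewrite /clip01 le_max lexx ge_max ler01 ge_min lexx. Qed.

Lemma clip01_id u : 0 <= u <= 1 -> clip01 u = u.
Proof. by move=> /andP[u0 u1]; rewrite /clip01 min_r// max_r. Qed.

Lemma measurable_clip01 : measurable_fun setT clip01.
Proof. by apply: measurable_maxr => //; exact: measurable_minr. Qed.

Lemma uniform_prob01E (A : set R) : measurable A ->
  uniform_prob (@ltr01 R) A = lebesgue_measure (A `&` `[0, 1]%classic).
Proof.
move=> mA; rewrite /uniform_prob integral_uniform_pdf.
have mAI : measurable (A `&` `[0, 1]%classic) by exact: measurableI.
rewrite -[RHS]mul1e -integral_cst//.
apply: eq_integral => x; rewrite inE => -[_ /=]; rewrite in_itv/= => x01.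
by rewrite /uniform_pdf x01 subr0 invr1.
Qed.

Lemma lebesgue_itv0 (t : R) : 0 <= t -> lebesgue_measure `[0, t]%classic = t%:E.
Proof.
rewrite le_eqVlt => /predU1P[<-|t0]; first by rewrite set_itv1 lebesgue_measure_set1.
by rewrite lebesgue_measure_itv/= lte_fin t0 -EFinD oppr0 addr0.
Qed.

Lemma uniform_prob01_le (t : R) : 0 <= t <= 1 ->
  uniform_prob (@ltr01 R) `]-oo, t]%classic = t%:E.
Proof.
move=> /andP[t0 t1]; rewrite uniform_prob01E// -lebesgue_itv0//.
congr lebesgue_measure; apply/seteqP; split => x /=; rewrite !in_itv/=.
  by move=> [-> /andP[->]].
by move=> /andP[-> xt]; rewrite xt (le_trans xt).
Qed.

Lemma uniform_prob01_clip (t : R) : 0 <= t <= 1 ->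
  uniform_prob (@ltr01 R) [set u | clip01 u <= t] = t%:E.
Proof.
move=> t01; rewrite -uniform_prob01_le// !uniform_prob01E//.
  congr lebesgue_measure; apply/seteqP; split => x /=; rewrite !in_itv/=;
  by move=> [xt x01]; split => //; rewrite clip01_id in xt *.
rewrite -[X in measurable X]setTI; apply: measurable_fun_ler => //.
exact: measurable_clip01.
Qed.

End uniform.
Arguments clip01 {R} u.

(** * Disintegration into two-point laws *)

Section reciprocal_width.
Context d (T : measurableType d) (R : realType) (P : probability T R).
Variables X U : {RV P >-> R}.

Local Notation Xp := (funrpos X).
Local Notation Xn := (funrneg X).
Local Notation Vp := (mass_transform P Xp (clip01 \o U)).
Local Notation Vn := (mass_transform P Xn (clip01 \o U)).
Local Notation qp := (mass_quantile P Xp).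
Local Notation qn := (mass_quantile P Xn).
Local Notation m := (mass_total P Xp).

(** An everywhere finite version of the width |X - r(X, U)|, as a function of
the values of X and U, so that its measurability with respect to these two
variables is visible. *)
Definition pair_width (z : R * R) : R :=
  if 0 < z.1 then z.1 + qn (mass_lt P Xp (Num.max z.1 0) + clip01 z.2 *
    (mass_le P Xp (Num.max z.1 0) - mass_lt P Xp (Num.max z.1 0)))
  else if z.1 < 0 then - z.1 + qp (mass_lt P Xn (Num.max (- z.1) 0) + clip01 z.2 *
    (mass_le P Xn (Num.max (- z.1) 0) - mass_lt P Xn (Num.max (- z.1) 0)))
  else 0.

Definition real_width (w : T) : R := pair_width (X w, U w).

Lemma real_widthE w : real_width w = if 0 < X w then X w + qn (Vp w)
  else if X w < 0 then - X w + qp (Vn w) else 0.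
Proof. by []. Qed.

Hypotheses (zX : zero_mean X) (uU : uniform01 U).
Hypothesis indXU : forall A B : set R, measurable A -> measurable B ->
  (P (X @^-1` A `&` U @^-1` B) = P (X @^-1` A) * P (U @^-1` B))%E.

Let mXp : measurable_fun setT Xp. Proof. exact: measurable_funrpos. Qed.
Let mXn : measurable_fun setT Xn. Proof. exact: measurable_funrneg. Qed.
Let Xp0 w : 0 <= Xp w. Proof. exact: funrpos_ge0. Qed.
Let Xn0 w : 0 <= Xn w. Proof. exact: funrneg_ge0. Qed.
Let iXp : P.-integrable setT (EFin \o Xp).
Proof. by apply: integrable_funrpos => //; case: zX. Qed.
Let iXn : P.-integrable setT (EFin \o Xn).
Proof. by apply: integrable_funrneg => //; case: zX. Qed.
Let mU : measurable_fun setT (clip01 \o U).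
Proof. exact: (measurableT_comp (@measurable_clip01 R) (measurable_funPT U)). Qed.
Let U01 w : 0 <= (clip01 \o U) w <= 1. Proof. exact: clip01_itv. Qed.

Let clip_independent (g : R -> R) x t : measurable_fun setT g -> 0 <= t <= 1 ->
  (P ([set w | g (X w) = x] `&` [set w | ((clip01 \o U) w <= t)%R]) =
   P [set w | g (X w) = x] * t%:E)%E.
Proof.
move=> mg t01; have mB : measurable [set u : R | clip01 u <= t].
  rewrite -[X in measurable X]setTI; apply: measurable_fun_ler => //.
  exact: measurable_clip01.
rewrite -(uniform_prob01_clip t01) -uU//.
apply: (indXU (A := [set y | g y = x])) => //.
by have := mg measurableT _ (measurable_set1 x); rewrite setTI.
Qed.

Let YUp x t : 0 <= t <= 1 ->
  (P ([set w | Xp w = x] `&` [set w | ((clip01 \o U) w <= t)%R]) =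
   P [set w | Xp w = x] * t%:E)%E.
Proof.
apply: (@clip_independent (fun y => Num.max y 0)).
exact: measurable_maxr.
Qed.

Let YUn x t : 0 <= t <= 1 ->
  (P ([set w | Xn w = x] `&` [set w | ((clip01 \o U) w <= t)%R]) =
   P [set w | Xn w = x] * t%:E)%E.
Proof.
apply: (@clip_independent (fun y => Num.max (- y) 0)).
exact: measurable_maxr.
Qed.

Let mVp : measurable_fun setT Vp. Proof. exact: measurable_mass_transform. Qed.
Let mVn : measurable_fun setT Vn. Proof. exact: measurable_mass_transform. Qed.
Let mqp : measurable_fun setT qp. Proof. exact: measurable_mass_quantile. Qed.
Let mqn : measurable_fun setT qn. Proof. exact: measurable_mass_quantile. Qed.

Let uniform_clip_ae : P [set w | ~~ (0 <= U w <= 1)] = 0%E.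
Proof.
have -> : P [set w | ~~ (0 <= U w <= 1)] = distribution P U (~` `[0, 1]%classic).
  by congr (P _); apply/seteqP; split => w /=; rewrite in_itv/= => /negP.
have mC : measurable (~` `[0, 1]%classic : set R) by exact: measurableC.
by rewrite uU// uniform_prob01E// setICl measure0.
Qed.

(** The exceptional event is that U is outside [0, 1], or that one of the two
transforms misses the open interval on which x_plus and x_minus are the finite
quantiles. *)
Lemma width_ae : exists N : set T, [/\ measurable N, P N = 0%E & forall w, ~ N w ->
  `|(X w)%:E - recip X (X w) (randomizer X U w)|%E = (real_width w)%:E].
Proof.
have mN0 : measurable [set w | ~~ (0 <= U w <= 1)].
  rewrite (_ : [set _ | _] = U @^-1` (~` `[0, 1]%classic)).
    rewrite -[X in measurable X]setTI; apply: measurable_funP => //.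
    exact: measurableC.
  by apply/seteqP; split => w /=; rewrite in_itv/= => /negP.
have mNV (Y V : T -> R) (k : R) : measurable_fun setT Y -> measurable_fun setT V ->
    measurable ([set w | 0 < Y w] `&` [set w | ~~ (0 < V w < k)]).
  move=> mY mV; apply: measurableI.
    by rewrite -[X in measurable X]setTI; exact: measurable_fun_ltr.
  rewrite (_ : [set w | ~~ _] = V @^-1` (~` `]0, k[%classic)).
    rewrite -[X in measurable X]setTI; apply: mV => //.
    by apply: measurableC; exact: measurable_itv.
  by apply/seteqP; split => w /=; rewrite in_itv/= => /negP.
have := mass_transform_itv_ae mXp Xp0 iXp mU U01 YUp.
have := mass_transform_itv_ae mXn Xn0 iXn mU U01 YUn.
set Nn := _ `&` _ => PNn; set Np := _ `&` _ => PNp.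
have mNn : measurable Nn by exact: mNV.
have mNp : measurable Np by exact: mNV.
exists ([set w | ~~ (0 <= U w <= 1)] `|` (Nn `|` Np)); split.
- by apply: measurableU => //; exact: measurableU.
- apply/negligibleP; first by apply: measurableU => //; exact: measurableU.
  apply: negligibleU; first exact/negligibleP.
  by apply: negligibleU; exact/negligibleP.
move=> w /not_orP[/negP + /not_orP[Nnw Npw]]; rewrite negbK => Uw.
have rU (Y : T -> R) : measurable_fun setT Y -> (forall w, 0 <= Y w) ->
    P.-integrable setT (EFin \o Y) ->
    [set v | Y v = Y w] = X @^-1` [set X w] ->
    mass_lt P Y (Y w) + randomizer X U w * (mass_le P Y (Y w) - mass_lt P Y (Y w))
    = mass_transform P Y (clip01 \o U) w.
  move=> mY Y0 iY E; rewrite /mass_transform /= clip01_id// /randomizer.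
  case: ifPn => //; rewrite negbK => /eqP PX.
  have := mass_jump mY Y0 iY (Y w); rewrite E PX mule0 => -[->].
  by rewrite !mulr0.
rewrite real_widthE; case: (ltgtP (X w) 0) => Xw.
- have XnE : Xn w = - X w by rewrite /funrneg max_l// oppr_ge0 ltW.
  have Vw : 0 < Vn w < m.
    rewrite -(mass_total_posneg zX); apply/negPn/negP => Vw; apply: Nnw; split => //=.
    by rewrite XnE oppr_gt0.
  have HE : recipH X (X w) (randomizer X U w) = Vn w.
    rewrite /recipH leNgt Xw /= (recipG_right_lt0 zX)// (recipG_le0 zX) ?ltW//.
    rewrite -XnE rU//; apply/seteqP; split => v /=; last by rewrite /funrneg => ->.
    rewrite XnE /funrneg; case: (leP 0 (X v)) => Xv.
      rewrite max_r ?oppr_le0// => /esym/eqP; rewrite oppr_eq0 => /eqP X0.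
      by rewrite X0 ltxx in Xw.
    by rewrite max_l ?oppr_ge0 ?(ltW Xv)// => /oppr_inj.
  rewrite /recip leNgt Xw /= HE (x_plusE zX)//.
  rewrite -EFinB /= ler0_norm; first by rewrite opprB addrC.
  by rewrite subr_le0 (le_trans (ltW Xw))// mass_quantile_ge0.
- have XpE : Xp w = X w by rewrite /funrpos max_l// ltW.
  have Vw : 0 < Vp w < m.
    by apply/negPn/negP => Vw; apply: Npw; split => //=; rewrite XpE.
  have HE : recipH X (X w) (randomizer X U w) = Vp w.
    rewrite /recipH (ltW Xw) (recipG_left_gt0 zX)// (recipG_ge0 X (ltW Xw)).
    rewrite -XpE rU//; apply/seteqP; split => v /=; last by rewrite /funrpos => ->.
    rewrite XpE /funrpos; case: (leP (X v) 0) => Xv.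
      by move=> X0; rewrite -X0 ltxx in Xw.
    by [].
  rewrite /recip (ltW Xw) HE (x_minusE zX)//.
  rewrite -EFinB /= opprK ger0_norm//.
  by rewrite addr_ge0 ?(ltW Xw)// mass_quantile_ge0.
- rewrite Xw /recip lexx /recipH lexx (recipG_left0 zX) (recipG_ge0 X (lexx 0)).
  rewrite (mass_le0 mXp Xp0 iXp (lexx 0)) subrr mulr0 addr0 (x_minus0 zX).
  by rewrite sube0 abse0.
Qed.

Lemma measurable_pair_width : measurable_fun setT pair_width.
Proof.
have mfst : measurable_fun setT (fun z : R * R => z.1) by exact: measurable_fst.
have msnd : measurable_fun setT (fun z : R * R => clip01 z.2).
  exact: (measurableT_comp (@measurable_clip01 R) measurable_snd).
have nd (f : R -> R) (g : R * R -> R) : {homo f : x y / x <= y} ->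
    measurable_fun setT g -> measurable_fun setT (fun z => f (g z)).
  by move=> ndf; apply: measurableT_comp; exact: nondecreasing_measurable.
have mtr (Y : T -> R) (g : R * R -> R) : measurable_fun setT Y ->
    (forall w, 0 <= Y w) -> P.-integrable setT (EFin \o Y) ->
    measurable_fun setT g -> measurable_fun setT
    (fun z => mass_lt P Y (g z) +
       clip01 z.2 * (mass_le P Y (g z) - mass_lt P Y (g z))).
  move=> mY Y0 iY mg.
  have mlt : measurable_fun setT (fun z => mass_lt P Y (g z)).
    by apply: nd => //; exact: mass_lt_nd.
  have mle : measurable_fun setT (fun z => mass_le P Y (g z)).
    by apply: nd => //; exact: mass_le_nd.
  apply: measurable_funD => //; apply: measurable_funM => //.
  exact: measurable_funB.
apply: measurable_fun_ifT; first exact: measurable_fun_ltr.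
  apply: measurable_funD; [exact: mfst|apply: (measurableT_comp mqn)].
  by apply: mtr => //; exact: measurable_maxr.
apply: measurable_fun_ifT => //; first exact: measurable_fun_ltr.
apply: measurable_funD => //; first exact: measurableT_comp.
apply: (measurableT_comp mqp); apply: mtr => //; apply: measurable_maxr => //.
exact: measurableT_comp.
Qed.

(** The quantile transform is applied to the positive and to the negative part
of X; both integrals are over ]0, m[ because the two parts have equal mass. *)
Lemma reciprocal_disintegration (Psi : R * R -> \bar R) :
  measurable_fun setT Psi -> (forall z, 0 <= Psi z)%E ->
  (\int[P]_w Psi (X w, real_width w) =
   \int[lebesgue_measure]_(h in `]0%R, m[)
     (Psi (qp h, qn h + qp h)%R * ((qp h)^-1)%:E +
      Psi (- qn h, qn h + qp h)%R * ((qn h)^-1)%:E) +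
   Psi (0, 0)%R * P (X @^-1` [set 0%R]))%E.
Proof.
move=> mPsi Psi0.
have mXge : measurable [set w | (0 < X w)%R].
  by rewrite -[X in measurable X]setTI; exact: measurable_fun_ltr.
have mXlt : measurable [set w | (X w < 0)%R].
  by rewrite -[X in measurable X]setTI; exact: measurable_fun_ltr.
have mX0 : measurable (X @^-1` [set 0]) by exact: measurable_funPTI.
have mG : measurable_fun setT (fun w => Psi (X w, real_width w)).
  apply: (measurableT_comp mPsi); apply: measurable_fun_pair => //.
  apply: (measurableT_comp measurable_pair_width).
  exact: measurable_fun_pair.
have TE : [set: T] = ([set w | (0 < X w)%R] `|` [set w | (X w < 0)%R]) `|`
    X @^-1` [set 0].
  apply/esym; rewrite -subTset => w _ /=; case: (ltgtP (X w) 0); first by left; right.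
    by left; left.
  by right.
rewrite TE ge0_integral_setU//; last 3 first.
- exact: measurableU.
- exact: measurable_funTS.
- apply/disj_setPS => w [/= +  X0]; rewrite X0.
  by rewrite ltxx => -[].
rewrite ge0_integral_setU//; last 2 first.
- exact: measurable_funTS.
- by apply/disj_setPS => w [/= + X0]; rewrite ltNge (ltW X0).
congr (_ + _)%E; last first.
  rewrite -integral_cst//; apply: eq_integral => w; rewrite inE /= => X0.
  by rewrite real_widthE X0 ltxx.
have mFp : measurable_fun setT (fun z : R * R => Psi (z.1, qn z.2 + z.1)).
  apply: (measurableT_comp mPsi); apply: measurable_fun_pair => //.
  apply: measurable_funD; last exact: measurable_fst.
  exact: (measurableT_comp mqn measurable_snd).
have mFn : measurable_fun setT (fun z : R * R => Psi (- z.1, z.1 + qp z.2)).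
  apply: (measurableT_comp mPsi); apply: measurable_fun_pair => //.
    exact: measurableT_comp.
  apply: measurable_funD; first exact: measurable_fst.
  exact: (measurableT_comp mqp measurable_snd).
transitivity (
    \int[P]_(w in [set w | (0 < Xp w)%R]) Psi (Xp w, qn (Vp w) + Xp w)%R +
    \int[P]_(w in [set w | (0 < Xn w)%R]) Psi (- Xn w, Xn w + qp (Vn w))%R)%E.
  congr (_ + _)%E.
    rewrite (_ : [set w | _] = [set w | 0 < Xp w]); last first.
      by apply/seteqP; split => w /=; rewrite /funrpos lt_max ltxx orbF.
    apply: eq_integral => w; rewrite inE /= /funrpos lt_max ltxx orbF => X0.
    by rewrite real_widthE X0 addrC max_l// ltW.
  rewrite (_ : [set w | _] = [set w | 0 < Xn w]); last first.
    by apply/seteqP; split => w /=; rewrite /funrneg lt_max ltxx orbF oppr_gt0.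
  apply: eq_integral => w; rewrite inE /= /funrneg lt_max ltxx orbF oppr_gt0 => X0.
  rewrite real_widthE X0 ltNge (ltW X0)/= max_l ?opprK// oppr_ge0.
  exact: ltW.
rewrite (quantile_transform_integral mXp Xp0 iXp mU U01 YUp mFp)//.
rewrite (quantile_transform_integral mXn Xn0 iXn mU U01 YUn mFn)//.
have mqE (q : R -> R) : measurable_fun setT q -> (forall h, 0 <= q h) ->
    measurable_fun setT (fun h => ((q h)^-1)%:E).
  by move=> mq q0; exact: measurable_EFin_inv.
have q0p h : 0 <= qp h by exact: mass_quantile_ge0.
have q0n h : 0 <= qn h by exact: mass_quantile_ge0.
rewrite (mass_total_posneg zX) [RHS]ge0_integralD//.
- by move=> h _; rewrite mule_ge0// lee_fin invr_ge0.
- apply: measurable_funTS; apply: emeasurable_funM; last exact: mqE.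
  apply: (measurableT_comp mFp (g := fun h => (qp h, h))).
  apply: measurable_fun_pair; [exact: mqp|exact: measurable_id].
- by move=> h _; rewrite mule_ge0// lee_fin invr_ge0.
- apply: measurable_funTS; apply: emeasurable_funM; last exact: mqE.
  apply: (measurableT_comp mFn (g := fun h => (qn h, h))).
  apply: measurable_fun_pair; [exact: mqn|exact: measurable_id].
Qed.

(** The disintegration of the constant c bounds that of Psi pointwise, and its
value is c because P is a probability. *)
Lemma two_point_bound (Psi : R * R -> \bar R) (c : \bar R) :
  measurable_fun setT Psi -> (forall z, 0 <= Psi z)%E ->
  (Psi (0, 0)%R <= c)%E ->
  (forall a b : R, (0 < a)%R -> (0 < b)%R ->
    (Psi (b, a + b)%R * (a / (a + b))%:E + Psi (- a, a + b)%R * (b / (a + b))%:E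
     <= c)%E) ->
  (\int[P]_w Psi (X w, real_width w) <= c)%E.
Proof.
move=> mPsi Psi0 Psi00 H.
have c0 : (0 <= c)%E by exact: le_trans Psi00.
have -> : c = (\int[P]_w cst c w)%E.
  by rewrite integral_cst//= probability_setT mule1.
rewrite (reciprocal_disintegration mPsi Psi0).
rewrite (@reciprocal_disintegration (cst c))//=.
apply: leeD; last by rewrite lee_wpmul2r.
have mq (q : R -> R) (g : R -> \bar R) : measurable_fun setT q ->
    (forall h, 0 <= q h) -> measurable_fun setT g ->
    measurable_fun setT (fun h => g h * ((q h)^-1)%:E)%E.
  by move=> mq q0 mg; apply: emeasurable_funM => //; exact: measurable_EFin_inv.
have mpair (f : R -> R) : measurable_fun setT f ->
    measurable_fun setT (fun h => Psi (f h, qn h + qp h)).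
  move=> mf; apply: (measurableT_comp mPsi (g := fun h => (f h, qn h + qp h))).
  apply: measurable_fun_pair; first exact: mf.
  by apply: measurable_funD; [exact: mqn|exact: mqp].
have q0p h : 0 <= qp h by exact: mass_quantile_ge0.
have q0n h : 0 <= qn h by exact: mass_quantile_ge0.
apply: ge0_le_integral => //.
- by move=> h _; rewrite adde_ge0// mule_ge0// lee_fin invr_ge0.
- apply: measurable_funTS; apply: emeasurable_funD.
    exact: (mq _ _ mqp q0p (mpair _ mqp)).
  apply: (mq _ _ mqn q0n); apply: mpair.
  exact: (measurableT_comp (@oppr_measurable R setT) mqn).
- apply: measurable_funTS; apply: emeasurable_funD.
    exact: (mq _ _ mqp q0p (measurable_cst c)).
  exact: (mq _ _ mqn q0n (measurable_cst c)).
move=> h; rewrite /= in_itv/= => hm.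
have b0 : 0 < qp h by exact: mass_quantile_gt0.
have a0 : 0 < qn h by apply: mass_quantile_gt0 => //; rewrite mass_total_posneg.
move: b0 a0 (H _ _ a0 b0); move: (qp h) (qn h) => b a b0 a0 {}H.
have s0 : 0 < a + b by exact: addr_gt0.
have t0 : 0 <= a^-1 + b^-1 by rewrite addr_ge0// invr_ge0 ltW.
have eb : b^-1 = (a / (a + b)) * (a^-1 + b^-1) by field; rewrite !gt_eqF.
have ea : a^-1 = (b / (a + b)) * (a^-1 + b^-1) by field; rewrite !gt_eqF.
have -> : (Psi (b, a + b)%R * (b^-1)%:E + Psi (- a, a + b)%R * (a^-1)%:E =
  (Psi (b, a + b)%R * (a / (a + b))%:E + Psi (- a, a + b)%R * (b / (a + b))%:E)
  * (a^-1 + b^-1)%:E)%E.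
  rewrite ge0_muleDl ?mule_ge0 ?lee_fin ?divr_ge0 ?(ltW a0) ?(ltW b0) ?(ltW s0)//.
  by rewrite -!muleA -!EFinM -eb -ea.
have -> : (c * (b^-1)%:E + c * (a^-1)%:E = c * (a^-1 + b^-1)%:E)%E.
  by rewrite -ge0_muleDr ?lee_fin ?invr_ge0 ?(ltW a0) ?(ltW b0)// -EFinD addrC.
by rewrite lee_wpmul2r// lee_fin.
Qed.

End reciprocal_width.

(** * Two-point variables built from uniform ones *)

Section le_integral_null_set.
Import HBNNSimple.

(** The integral of a nonnegative function is a supremum over simple functions
below it, so f may fail to be measurable. It is applied to f(S_W), which is
compared with a measurable function that it equals almost surely. *)
Lemma le_integral_null_set d (T : measurableType d) (R : realType)
    (mu : {measure set T -> \bar R}) (f g : T -> \bar R) (N : set T) :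
  (forall w, 0 <= f w)%E -> (forall w, 0 <= g w)%E -> measurable_fun setT g ->
  measurable N -> mu N = 0%E -> (forall w, ~ N w -> f w <= g w)%E ->
  (\int[mu]_w f w <= \int[mu]_w g w)%E.
Proof.
move=> f0 g0 mg mN N0 fg; rewrite [leLHS]ge0_integralTE//.
apply: ge_ereal_sup => _ [h /= hf <-].
rewrite -integralT_nnsfun.
rewrite (@ge0_negligible_integral _ _ _ mu _ N)//; last 2 first.
- exact/measurable_EFinP/measurable_funTS.
- by move=> w _; rewrite lee_fin.
rewrite [leRHS](@ge0_negligible_integral _ _ _ mu _ N)//.
apply: ge0_le_integral => //.
- exact: measurableD.
- by move=> w _; rewrite lee_fin.
- exact/measurable_EFinP/measurable_funTS.
- exact: measurable_funTS.
- by move=> w [_ Nw]; exact: le_trans (hf w) (fg w Nw).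
Qed.

End le_integral_null_set.

Section two_point.
Context (R : realType).

(** A zero-mean function of a uniform u, in the cases listed in [balanced]. For
a = b = 0 the weight a / (a + b) is 0 / 0 = 0 and the value is always 0. *)
Definition two_point (a b u : R) : R := if u <= a / (a + b) then b else - a.

Definition balanced (a b : R) : Prop := (a = 0 /\ b = 0) \/ (0 < a /\ 0 < b).

Lemma measurable_two_point a b : measurable_fun setT (two_point a b).
Proof. by apply: measurable_fun_ifT => //; exact: measurable_fun_ler. Qed.

Lemma two_point_scale a b D u : 0 < D ->
  two_point (a / D) (b / D) u = two_point a b u / D.
Proof.
move=> D0; rewrite /two_point -mulrDl invfM invrK mulrACA mulVf ?mulr1 ?gt_eqF//.
by case: ifP => // _; rewrite mulNr.
Qed.

Lemma balanced_scale a b D : 0 < D -> balanced a b -> balanced (a / D) (b / D).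
Proof.
move=> D0 [[-> ->]|[a0 b0]]; first by left; rewrite mul0r.
by right; rewrite !divr_gt0.
Qed.

Lemma balanced_weight a b : balanced a b -> 0 <= a / (a + b) <= 1.
Proof.
move=> [[-> ->]|[a0 b0]]; first by rewrite mul0r lexx ler01.
have s0 : 0 < a + b by exact: addr_gt0.
by rewrite divr_ge0 ?(ltW a0) ?(ltW s0)//= ler_pdivrMr// mul1r lerDl ltW.
Qed.

Context d (T : measurableType d) (P : probability T R) (U : {RV P >-> R}).
Hypothesis uU : uniform01 U.

Lemma uniform_le t : 0 <= t <= 1 -> P [set w | U w <= t] = t%:E.
Proof.
by move=> t01; rewrite -(uniform_prob01_le t01) -uU.
Qed.

Lemma uniform_gt t : 0 <= t <= 1 -> P [set w | t < U w] = (1 - t)%:E.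
Proof.
move=> t01; rewrite EFinB -(uniform_le t01).
rewrite (_ : [set w | t < U w] = ~` [set w | U w <= t]).
  rewrite probability_setC// -[X in measurable X]setTI; exact: measurable_fun_ler.
by apply/seteqP; split => w /=; rewrite ltNge => /negP.
Qed.

Lemma integral_two_point (h : R -> \bar R) a b : balanced a b ->
  (forall x, 0 <= h x)%E ->
  (\int[P]_w h (two_point a b (U w)) =
   h b * (a / (a + b))%:E + h (- a)%R * (1 - a / (a + b))%:E)%E.
Proof.
move=> /balanced_weight p01 h0; set p := a / (a + b) in p01 *.
have mle : measurable [set w | U w <= p].
  by rewrite -[X in measurable X]setTI; exact: measurable_fun_ler.
have mgt : measurable [set w | p < U w].
  by rewrite -[X in measurable X]setTI; exact: measurable_fun_ltr.
have TE : [set w | U w <= p] `|` [set w | p < U w] = [set: T].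
  by rewrite -subTset => w _ /=; case: (leP (U w) p); [left|right].
rewrite -TE ge0_integral_setU//; last 2 first.
- rewrite TE (_ : (fun w => _) = fun w => if U w <= p then h b else h (- a)).
    by apply: measurable_fun_ifT => //; exact: measurable_fun_ler.
  by apply/funext => w; rewrite /two_point -/p; case: ifP.
- by apply/disj_setPS => w [/= wp]; rewrite ltNge wp.
congr (_ + _)%E.
  rewrite -(uniform_le p01) -integral_cst//.
  by apply: eq_integral => w; rewrite inE /= /two_point -/p => ->.
rewrite -(uniform_gt p01) -integral_cst//.
by apply: eq_integral => w; rewrite inE /= /two_point -/p ltNge => /negbTE ->.
Qed.

End two_point.

Lemma independent_pair d (T : measurableType d) (R : realType)
    (P : probability T R) (I : finType) (X : I -> {RV P >-> R}) (i j : I) :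
  mutually_independent X -> i != j ->
  forall A B : set R, measurable A -> measurable B ->
  (P (X i @^-1` A `&` X j @^-1` B) = P (X i @^-1` A) * P (X j @^-1` B))%E.
Proof.
move=> indX ij A B mA mB.
apply: (@independent_preimages _ _ _ P I X indX _ _ R R [set i]%SET [set j]%SET).
- by rewrite disjoints1 inE.
- by apply: measurable_cylinder_coord; rewrite inE.
- by apply: measurable_cylinder_coord; rewrite inE.
- by [].
- by [].
Qed.

(** * Replacing one pair at a time *)

Section replacement.
Context (R : realType) d (T : measurableType d) (P : probability T R) (n : nat).
Variables X U : 'I_n -> {RV P >-> R}.

Definition joint_family (s : 'I_n + 'I_n) : {RV P >-> R} :=
  match s with inl i => X i | inr i => U i end.

Hypothesis zX : forall i, zero_mean (X i).
Hypothesis uU : forall i, uniform01 (U i).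
Hypothesis indXU : mutually_independent joint_family.

Implicit Types (g : 'I_n -> R * R -> R * R) (Phi : R * R -> \bar R).

Definition summand g i w : R * R := g i (X i w, U i w).

Definition partial_sum g (A : pred 'I_n) w : R * R :=
  (\sum_(i < n | A i) (summand g i w).1, \sum_(i < n | A i) (summand g i w).2).

Definition coordinates (A : pred 'I_n) : {set 'I_n + 'I_n} :=
  [set s | match s with inl i => A i | inr i => A i end]%SET.

Lemma measurable_summand_cylinder g (A : pred 'I_n) i : A i ->
  measurable_fun setT (g i) -> measurable_fun setT
  (summand g i :
     g_sigma_algebraType (cylinder joint_family (coordinates A)) -> R * R).
Proof.
move=> Ai mg; apply: (measurableT_comp mg); apply: measurable_fun_pair.
- by apply: (@measurable_cylinder_coord _ _ _ _ _ joint_family _ (inl i)); rewrite inE.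
- by apply: (@measurable_cylinder_coord _ _ _ _ _ joint_family _ (inr i)); rewrite inE.
Qed.

Lemma measurable_partial_sum_cylinder g (A : pred 'I_n) :
  (forall i, measurable_fun setT (g i)) -> measurable_fun setT
  (partial_sum g A :
     g_sigma_algebraType (cylinder joint_family (coordinates A)) -> R * R).
Proof.
move=> mg; apply: measurable_fun_pair.
  rewrite (_ : (fun w => _) = fun w => \sum_(i < n)
    (if A i then (summand g i w).1 else 0)); last first.
    by apply/funext => w; rewrite [LHS]big_mkcond.
  apply: measurable_sum => i; case: (boolP (A i)) => // Ai.
  apply: (measurableT_comp measurable_fst).
  exact: (measurable_summand_cylinder Ai (mg i)).
rewrite (_ : (fun w => _) = fun w => \sum_(i < n)
  (if A i then (summand g i w).2 else 0)); last first.
  by apply/funext => w; rewrite [LHS]big_mkcond.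
apply: measurable_sum => i; case: (boolP (A i)) => // Ai.
apply: (measurableT_comp measurable_snd).
exact: (measurable_summand_cylinder Ai (mg i)).
Qed.

Lemma measurable_partial_sum g (A : pred 'I_n) :
  (forall i, measurable_fun setT (g i)) -> measurable_fun setT (partial_sum g A).
Proof.
by move=> mg; exact: (measurable_fun_cylinder (measurable_partial_sum_cylinder mg)).
Qed.

(** By independence, the conditional expectation of Phi of the whole sum, given
that the k-th summand is z. *)
Definition partial_expectation Phi g k (z : R * R) : \bar R :=
  (\int[P]_w Phi (z.1 + (partial_sum g (predC1 k) w).1,
                  z.2 + (partial_sum g (predC1 k) w).2)%R)%E.

Lemma measurable_partial_expectation Phi g k : measurable_fun setT Phi ->
  (forall z, 0 <= Phi z)%E -> (forall i, measurable_fun setT (g i)) ->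
  measurable_fun setT (partial_expectation Phi g k).
Proof.
move=> mPhi Phi0 mg.
pose f (zw : (R * R) * T) := Phi (zw.1.1 + (partial_sum g (predC1 k) zw.2).1,
  zw.1.2 + (partial_sum g (predC1 k) zw.2).2).
apply: (@measurable_fun_fubini_tonelli_F _ _ (R * R)%type T R P f); last first.
  by move=> zw; exact: Phi0.
have mt : measurable_fun setT (fun zw : (R * R) * T => partial_sum g (predC1 k) zw.2).
  exact: (measurableT_comp (measurable_partial_sum _ mg) measurable_snd).
apply: (measurableT_comp mPhi); apply: measurable_fun_pair; apply: measurable_funD.
- exact: (measurableT_comp measurable_fst measurable_fst).
- exact: (measurableT_comp measurable_fst mt).
- exact: (measurableT_comp measurable_snd measurable_fst).
- exact: (measurableT_comp measurable_snd mt).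
Qed.

Lemma partial_expectation_ge0 Phi g k z : (forall z, 0 <= Phi z)%E ->
  (0 <= partial_expectation Phi g k z)%E.
Proof. by move=> Phi0; exact: integral_ge0. Qed.

(** The k-th summand and the sum of the others are measurable with respect to
disjoint families of coordinates, so they are decoupled by independence. *)
Lemma integral_partial_sum Phi g k : measurable_fun setT Phi ->
  (forall z, 0 <= Phi z)%E -> (forall i, measurable_fun setT (g i)) ->
  (\int[P]_w Phi (partial_sum g xpredT w) =
   \int[P]_w partial_expectation Phi g k (summand g k w))%E.
Proof.
move=> mPhi Phi0 mg.
pose F (z : (R * R) * (R * R)) := Phi (z.1.1 + z.2.1, z.1.2 + z.2.2).
have mF : measurable_fun setT F.
  apply: (measurableT_comp mPhi); apply: measurable_fun_pair; apply: measurable_funD.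
  - exact: (measurableT_comp measurable_fst measurable_fst).
  - exact: (measurableT_comp measurable_fst measurable_snd).
  - exact: (measurableT_comp measurable_snd measurable_fst).
  - exact: (measurableT_comp measurable_snd measurable_snd).
rewrite -(@independent_decoupling _ _ _ P _ joint_family indXU _ _ _ _
  (coordinates (pred1 k)) (coordinates (predC1 k))
  (summand g k) (partial_sum g (predC1 k)) _ _ _ F)//.
- apply: eq_integral => w _; rewrite /F; congr Phi.
  by rewrite /partial_sum /=; congr pair; rewrite (bigD1 k).
- rewrite -setI_eq0; apply/eqP/setP => -[i|i]; rewrite !inE /=; exact: andbN.
- by apply: measurable_summand_cylinder => /=.
- exact: measurable_partial_sum_cylinder.
- by move=> z; exact: Phi0.
Qed.

(** Widths are squared so that the numerator and the radicand of S_W are the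
two coordinates of a single sum. *)
Definition width_summand (i : 'I_n) (z : R * R) : R * R :=
  (z.1, pair_width (X i) z ^+ 2).

Definition two_point_summand (a b : R) (z : R * R) : R * R :=
  (two_point a b z.2, (a + b) ^+ 2).

Lemma measurable_width_summand i : measurable_fun setT (width_summand i).
Proof.
apply: measurable_fun_pair; first exact: measurable_fst.
by apply: measurable_funX; exact: measurable_pair_width.
Qed.

Lemma measurable_two_point_summand a b : measurable_fun setT (two_point_summand a b).
Proof.
apply: measurable_fun_pair => //.
exact: (measurableT_comp (measurable_two_point a b) measurable_snd).
Qed.

(** Otherwise [two_point_bound], applied to the expectation in terms of the k-th
summand, would bound the integral by c. The replacement leaves the law of the
other summands unchanged. *)
Lemma replace_one Phi g k (c : \bar R) : measurable_fun setT Phi ->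
  (forall z, 0 <= Phi z)%E -> (forall i, measurable_fun setT (g i)) ->
  g k = width_summand k -> (c < \int[P]_w Phi (partial_sum g xpredT w))%E ->
  exists a b, balanced a b /\ (c < \int[P]_w Phi
    (partial_sum (fun i => if i == k then two_point_summand a b else g i) xpredT w))%E.
Proof.
move=> mPhi Phi0 mg gk cPhi; apply: contrapT => noab.
have {noab} H a b : balanced a b -> (\int[P]_w Phi
    (partial_sum (fun i => if i == k then two_point_summand a b else g i)
       xpredT w) <= c)%E.
  by move=> ab; rewrite leNgt; apply/negP => h; apply: noab; exists a, b.
have mPsi := measurable_partial_expectation k mPhi Phi0 mg.
have Psi0 z := partial_expectation_ge0 g k z Phi0.
set Psi := partial_expectation Phi g k in mPsi Psi0.
have {}H a b : balanced a b ->
    (Psi (b, (a + b) ^+ 2)%R * (a / (a + b))%:E +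
     Psi (- a, (a + b) ^+ 2)%R * (1 - a / (a + b))%:E <= c)%E.
  move=> ab; have := H a b ab.
  set g' := (X in partial_sum X); have mg' i : measurable_fun setT (g' i).
    by rewrite /g'; case: ifP => // _; exact: measurable_two_point_summand.
  rewrite (@integral_partial_sum Phi g' k)//.
  have <- := integral_two_point (uU k) ab (fun x => Psi0 (x, (a + b) ^+ 2)).
  suff -> : (\int[P]_w partial_expectation Phi g' k (summand g' k w) =
    \int[P]_w Psi (two_point a b (U k w), (a + b) ^+ 2)%R)%E by [].
  have g'E : partial_expectation Phi g' k = Psi.
    apply/funext => z; apply: eq_integral => v _; congr (Phi (_ + _, _ + _)).
      by apply: eq_bigr => i /negbTE ik; rewrite /summand /g' ik.
    by apply: eq_bigr => i /negbTE ik; rewrite /summand /g' ik.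
  by apply: eq_integral => w _; rewrite g'E /summand /g' eqxx.
move: cPhi; rewrite ltNge => /negP; apply.
rewrite (@integral_partial_sum Phi g k)// -/Psi /summand gk.
pose Psi2 (z : R * R) := Psi (z.1, z.2 ^+ 2).
apply: (@two_point_bound _ _ _ _ (X k) (U k) (zX k) (uU k) _ Psi2).
- exact: (independent_pair (i := inl k) (j := inr k) indXU).
- apply: (measurableT_comp mPsi); apply: measurable_fun_pair; first exact: measurable_fst.
  by apply: measurable_funX; exact: measurable_snd.
- by move=> z; exact: Psi0.
- have := H 0 0 (or_introl (conj erefl erefl)).
  by rewrite !mul0r mule0 add0e subr0 mule1 oppr0 addr0.
- move=> a b a0 b0; have := H a b (or_intror (conj a0 b0)).
  have -> : 1 - a / (a + b) = b / (a + b).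
    have s0 : a + b != 0 by rewrite gt_eqF// addr_gt0.
    by field.
  by [].
Qed.

Lemma replace_all Phi (c : \bar R) : measurable_fun setT Phi ->
  (forall z, 0 <= Phi z)%E ->
  (c < \int[P]_w Phi (partial_sum width_summand xpredT w))%E ->
  exists a b : 'I_n -> R, (forall i, balanced (a i) (b i)) /\
  (c < \int[P]_w Phi
    (partial_sum (fun i => two_point_summand (a i) (b i)) xpredT w))%E.
Proof.
move=> mPhi Phi0 cPhi.
pose g (k : nat) (a b : 'I_n -> R) (i : 'I_n) :=
  if (i < k)%N then two_point_summand (a i) (b i) else width_summand i.
have mg k a b i : measurable_fun setT (g k a b i).
  rewrite /g; case: ifP => _; first exact: measurable_two_point_summand.
  exact: measurable_width_summand.
have H k : (k <= n)%N -> exists a b : 'I_n -> R, (forall i, balanced (a i) (b i)) /\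
  (c < \int[P]_w Phi (partial_sum (g k a b) xpredT w))%E.
  elim: k => [_|k IHk kn].
    by exists (fun=> 0), (fun=> 0); split => // i; left.
  have [a [b [ab cg]]] := IHk (ltnW kn).
  pose i0 := Ordinal kn.
  have [|a0 [b0 [ab0 c0]]] := replace_one (k := i0) mPhi Phi0 (mg k a b) _ cg.
    by rewrite /g ltnn.
  exists (fun i => if i == i0 then a0 else a i), (fun i => if i == i0 then b0 else b i).
  split; first by move=> i; case: eqP.
  move: c0; congr (c < _)%E; apply: eq_integral => w _; congr (Phi (partial_sum _ _ w)).
  apply/funext => i; rewrite /g ltnS; have [->|ik] := eqVneq i i0.
    by rewrite leqnn.
  rewrite [in RHS]leq_eqVlt.
  by rewrite (_ : (i == k :> nat) = false)//; apply/negbTE.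
have [a [b [ab cg]]] := H n (leqnn n).
exists a, b; split => //; move: cg; congr (c < _)%E.
apply: eq_integral => w _; congr (Phi (partial_sum _ _ w)).
by apply/funext => i; rewrite /g ltn_ord.
Qed.

End replacement.

(** * The self-normalized sum *)

Section two_point_variables.
Context (R : realType) d (T : measurableType d) (P : probability T R) (n : nat).
Variables X U : 'I_n -> {RV P >-> R}.
Hypothesis uU : forall i, uniform01 (U i).
Hypothesis indXU : mutually_independent (joint_family X U).

Lemma independent_functions_of_U (h : 'I_n -> R -> R) (Z : 'I_n -> {RV P >-> R}) :
  (forall i, measurable_fun setT (h i)) ->
  (forall i w, Z i w = h i (U i w)) -> mutually_independent Z.
Proof.
move=> mh ZE J A mA.
have ZU i : Z i @^-1` A i = U i @^-1` (h i @^-1` A i).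
  by apply/seteqP; split => w /=; rewrite ZE.
pose B (s : 'I_n + 'I_n) : set R :=
  match s with inl _ => setT | inr i => h i @^-1` A i end.
have mB s : measurable (B s).
  by case: s => i //=; rewrite -[X in measurable X]setTI; exact: mh.
have := indXU [set inr i | i in J]%SET mB.
rewrite big_imset/=; last by move=> i j _ _ [].
rewrite [in X in X -> _](_ : \bigcap_(s in _) _ =
    \bigcap_(i in [set` J]) Z i @^-1` A i).
  by move=> ->; apply: eq_bigr => i _; rewrite ZU.
apply/seteqP; split => [w H i iJ|w H s /=].
  by rewrite ZU; apply: (H (inr i)) => /=; apply/imsetP; exists i.
by move=> /imsetP[i iJ ->]; have := H i iJ; rewrite ZU.
Qed.

Variable Z : {RV P >-> R}.
Variables (i : 'I_n) (a b : R).
Hypothesis ab : balanced a b.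
Hypothesis ZE : forall w, Z w = two_point a b (U i w).

Let balanced_ge0 : 0 <= a /\ 0 <= b.
Proof. by case: ab => [[-> ->]|[/ltW a0 /ltW b0]]. Qed.

Lemma two_point_zero_mean : zero_mean Z.
Proof.
have [a0 b0] := balanced_ge0.
have EZ (h : R -> \bar R) : (forall x, 0 <= h x)%E -> (\int[P]_w h (Z w) =
    h b * (a / (a + b))%:E + h (- a)%R * (1 - a / (a + b))%:E)%E.
  move=> h0; rewrite -(integral_two_point (uU i) ab h0).
  by apply: eq_integral => w _; rewrite ZE.
split.
  apply/integrableP; split; first exact/measurable_EFinP.
  rewrite (EZ (fun x => `|x%:E|%E))//=.
  by rewrite -!EFinM -EFinD ltry.
rewrite unlock integralE.
under eq_integral do rewrite funeposE.
under [X in (_ - X)%E]eq_integral do rewrite funenegE.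
rewrite (EZ (fun x => maxe x%:E 0)); last by move=> x; rewrite le_max lexx orbT.
rewrite (EZ (fun x => maxe (- x%:E) 0)%E); last by move=> x; rewrite le_max lexx orbT.
have maxp (x : R) : 0 <= x -> maxe x%:E 0 = x%:E by move=> x0; rewrite max_l ?lee_fin.
have maxn (x : R) : 0 <= x -> maxe (- x%:E)%E 0 = 0%E.
  by move=> x0; rewrite max_r// oppe_le0 lee_fin.
rewrite (maxp b)// (maxn b)// [maxe (- a)%:E 0]maxn// -EFinN opprK (maxp a)//.
rewrite !mul0e adde0 add0e -!EFinM -EFinN -EFinD.
congr EFin; case: ab => [[-> ->]|[a1 b1]]; first by rewrite !mul0r subrr.
have s0 : a + b != 0 by rewrite gt_eqF// addr_gt0.
by field.
Qed.

Lemma two_point_two_valued : two_valued Z (- a) b.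
Proof.
have p01 := balanced_weight ab.
have mZ (B : set R) : measurable B -> measurable (Z @^-1` B).
  by move=> mB; exact: measurable_funPTI.
split.
- rewrite -(probability_setT P); congr (P _); rewrite -subTset => w _ /=.
  by rewrite ZE /two_point; case: ifP; [right|left].
- case: (ab) => [[a0 b0]|[a0 b0]].
    rewrite (_ : _ @^-1` _ = setT) ?probability_setT ?lte01//.
    by rewrite -subTset => w _ /=; rewrite ZE /two_point a0 b0 oppr0 if_same.
  apply: (@lt_le_trans _ _ (P [set w | a / (a + b) < U i w])).
    rewrite (uniform_gt (uU i) p01) lte_fin subr_gt0.
    by rewrite ltr_pdivrMr ?addr_gt0// mul1r ltrDl.
  apply: le_measure; rewrite ?inE; [|exact: mZ|].
    by rewrite -[X in measurable X]setTI; exact: measurable_fun_ltr.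
  by move=> w /=; rewrite ZE /two_point ltNge => /negbTE ->.
- case: (ab) => [[a0 b0]|[a0 b0]].
    rewrite (_ : _ @^-1` _ = setT) ?probability_setT ?lte01//.
    by rewrite -subTset => w _ /=; rewrite ZE /two_point a0 b0 oppr0 if_same.
  apply: (@lt_le_trans _ _ (P [set w | U i w <= a / (a + b)])).
    rewrite (uniform_le (uU i) p01) lte_fin.
    by rewrite divr_gt0 ?addr_gt0.
  apply: le_measure; rewrite ?inE; [|exact: mZ|].
    by rewrite -[X in measurable X]setTI; exact: measurable_fun_ler.
  by move=> w /=; rewrite ZE /two_point => ->.
Qed.

End two_point_variables.

Definition normalized (R : realType) (z : R * R) : R :=
  z.1 / (2^-1 * Num.sqrt z.2).

Lemma measurable_normalized (R : realType) : measurable_fun setT (@normalized R).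
Proof.
have minv : measurable_fun setT (fun x : R => Num.sqrt x).
  apply: continuous_measurable_fun; exact: sqrt_continuous.
apply: measurable_funM; first exact: measurable_fst.
have := @measurable_EFin_inv _ (R * R)%type R (fun z => 2^-1 * Num.sqrt z.2).
move=> H; apply/measurable_EFinP; apply: H.
  apply: measurable_funM => //; exact: (measurableT_comp minv measurable_snd).
by move=> z; rewrite mulr_ge0// ?invr_ge0// sqrtr_ge0.
Qed.

(** Division by zero in a field gives 0, so the rule 0 / 0 = 0 needs no case
distinction in [normalized]. *)
Lemma self_normalized_sumE d (T : measurableType d) (R : realType)
    (P : probability T R) n (X U : 'I_n -> {RV P >-> R}) w (r : 'I_n -> R) :
  (forall i, width X U i w = (r i)%:E) ->
  self_normalized_sum X U w = normalized (\sum_(i < n) X i w, \sum_(i < n) r i ^+ 2).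
Proof.
move=> rE; rewrite /self_normalized_sum.
have -> : half_root_width X U w = (2^-1 * Num.sqrt (\sum_(i < n) r i ^+ 2))%:E.
  rewrite /half_root_width; under eq_bigr do rewrite rE -EFin_expe.
  by rewrite sumEFin.
rewrite eqe /normalized /=; case: eqP => [->|/eqP D0]; first by rewrite invr0 mulr0.
by rewrite inver (negbTE D0) -EFinM.
Qed.

Theorem theorem2p3 (R : realType) (d : measure_display) (T : measurableType d)
    (P : probability T R) (n : nat) (X U : 'I_n -> {RV P >-> R})
    (zero_mean_X : forall i, zero_mean (X i))
    (uniform_U : forall i, uniform01 (U i))
    (independent_XU : mutually_independent
      (fun s : 'I_n + 'I_n => match s with inl i => X i | inr i => U i end))
    (f : R -> R) (measurable_f : measurable_fun setT f)
    (f_ge0 : forall x, 0 <= f x) :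
  ('E_P[fun w => f (self_normalized_sum X U w)] <=
   maxe (f 0)%:E
     (ereal_sup [set e : \bar R |
        exists (d' : measure_display) (T' : measurableType d')
          (Q : probability T' R) (Z : 'I_n -> {RV Q >-> R}) (a b : 'I_n -> R),
          [/\ mutually_independent Z,
              forall i, zero_mean (Z i),
              forall i, two_valued (Z i) (a i) (b i),
              (2^-1 * Num.sqrt (\sum_(i < n) (b i - a i) ^+ 2) = 1)%R &
              e = 'E_Q[fun w => f (\sum_(i < n) Z i w)%R]]]))%E.
Proof.
rewrite expectation.unlock leNgt; apply/negP; set c := maxe _ _ => c_lt.
have indXU : mutually_independent (joint_family X U) by exact: independent_XU.
pose Phi (z : R * R) : \bar R := (f (normalized z))%:E.
have mPhi : measurable_fun setT Phi.
  apply/measurable_EFinP; exact: (measurableT_comp measurable_f (@measurable_normalized R)).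
have Phi0 z : (0 <= Phi z)%E by rewrite lee_fin.
have {}c_lt : (c < \int[P]_w Phi
    (partial_sum X U (@width_summand _ _ _ _ _ X) xpredT w))%E.
  apply: (lt_le_trans c_lt).
  have widthX i : exists N : set T, [/\ measurable N, P N = 0%E & forall w, ~ N w ->
      width X U i w = (real_width (X i) (U i) w)%:E].
    apply: width_ae => //.
    exact: (independent_pair (i := inl i) (j := inr i) indXU).
  have [N NE] := choice widthX.
  apply: (@le_integral_null_set _ _ _ _ _ _ (\big[setU/set0]_(i < n) N i)) => //.
  - by move=> w; rewrite lee_fin.
  - apply: (measurableT_comp mPhi); apply: measurable_partial_sum => i.
    exact: measurable_width_summand.
  - by apply: bigsetU_measurable => i _; case: (NE i).
  - apply/negligibleP.
      by apply: bigsetU_measurable => i _; case: (NE i).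
    elim/big_ind: _ => [|A B|i _]; [exact: negligible_set0|exact: negligibleU|].
    by have [mN N0 _] := NE i; exact/negligibleP.
  - move=> w /= Nw; rewrite (@self_normalized_sumE _ _ _ _ _ _ _ _
      (fun i => real_width (X i) (U i) w))//.
    move=> i; have [_ _] := NE i; apply => Niw; apply: Nw.
    by rewrite (bigD1 i)//=; left.
have [a [b [ab {}c_lt]]] := replace_all zero_mean_X uniform_U indXU mPhi Phi0 c_lt.
pose D := 2^-1 * Num.sqrt (\sum_(i < n) (a i + b i) ^+ 2).
have E w : Phi (partial_sum X U (fun i => two_point_summand (a i) (b i)) xpredT w) =
    (f ((\sum_(i < n) two_point (a i) (b i) (U i w)) / D))%:E by [].
have D_ge0 : 0 <= D by rewrite mulr_ge0// ?invr_ge0// sqrtr_ge0.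
move: c_lt; under eq_integral do rewrite E.
apply/negP; rewrite -leNgt.
(* When D = 0 the integrand is f (x / 0) = f 0. *)
move: D_ge0; rewrite le_eqVlt => /predU1P[D0|D_gt0].
  under eq_integral do rewrite -D0 invr0 mulr0.
  rewrite integral_cst//= probability_setT mule1.
  by rewrite /c le_max lexx.
pose Zf i w := two_point (a i / D) (b i / D) (U i w).
have mZ i : measurable_fun setT (Zf i).
  apply: (measurableT_comp (measurable_two_point _ _)); exact: measurable_funPT.
pose Z i : {RV P >-> R} := HB.pack (Zf i) (isMeasurableFun.Build _ _ _ _ (Zf i) (mZ i)).
rewrite /c le_max; apply/orP; right; apply: ereal_sup_ubound => /=.
exists d, T, P, Z, (fun i => - (a i / D)), (fun i => b i / D); split.
- apply: (independent_functions_of_U indXU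
    (h := fun i => two_point (a i / D) (b i / D))) => // i.
  exact: measurable_two_point.
- move=> i; apply: (two_point_zero_mean uniform_U (i := i) (balanced_scale D_gt0 (ab i))).
  by [].
- move=> i; apply: (two_point_two_valued uniform_U (i := i) (balanced_scale D_gt0 (ab i))).
  by [].
- rewrite (eq_bigr (fun i => (D^-1) ^+ 2 * (a i + b i) ^+ 2)); last first.
    by move=> i _; rewrite opprK -mulrDl exprMn mulrC addrC.
  rewrite -mulr_sumr sqrtrM ?sqr_ge0// sqrtr_sqr ger0_norm ?invr_ge0 ?ltW//.
  by rewrite mulrCA -/D mulVf// gt_eqF.
- apply: eq_integral => w _; congr (f _)%:E.
  by rewrite mulr_suml; apply: eq_bigr => i _; rewrite -two_point_scale.
Qed.
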